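(* Assume conditions (C1), (C2), (C3) listed in the context, with $\nu\in[0,\infty)$ the constant appearing in (C2), and assume that there are $\lambda_k\in[0,\infty)$, $k=1,2,\ldots$, such that \[ \lim_{n\to\infty}\frac{m_{n,k}}{k!\,(1-\overline{f}_n)}=\lambda_k,\quad k=1,2,\ldots,\qquad\text{and}\qquad \limsup_{n\to\infty}\lambda_n^{1/n}\le 1 . \] Then the Galton--Watson process in varying environment with immigration $(Y_n)$ satisfies $Y_n\to Y$ in distribution as $n\to\infty$, where the random variable $Y$ has a compound-Poisson distribution with generating function, for $s\in(0,1]$, \[ f_Y(s)=\exp\left\{-\sum_{k=1}^{\infty}\frac{2^k\lambda_k}{\nu^k}\left(\log\left(1+\frac{\nu}{2}(1-s)\right)+\sum_{i=1}^{k-1}(-1)^i\frac{\nu^i}{i\,2^i}(1-s)^i\right)\right\}, \] where for $\nu=0$ each summand is understood as its limit as $\nu\downarrow0$, i.e. $f_Y(s)=\exp\left\{\sum_{k=1}^{\infty}(-1)^k\frac{\lambda_k}{k}(1-s)^k\right\}$.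
   Context: Let $\mathbb{N}=\{1,2,\ldots\}$. Let $\{\xi_{n,j},\varepsilon_n\}_{n,j\in\mathbb{N}}$ be independent nonnegative integer-valued random variables such that for each $n$ the variables $\xi_n,\xi_{n,1},\xi_{n,2},\ldots$ are identically distributed. Define $Y_0=0$ and $Y_n=\sum_{j=1}^{Y_{n-1}}\xi_{n,j}+\varepsilon_n$ for $n\in\mathbb{N}$. Let $f_n(s)=\mathbf{E}\,s^{\xi_n}$, $s\in[0,1]$, be the offspring generating function of generation $n$, and $\overline{f}_n=f_n'(1)=\mathbf{E}\,\xi_n$; $f_n''(1)=\mathbf{E}[\xi_n(\xi_n-1)]$ and $f_n'''(1)=\mathbf{E}[\xi_n(\xi_n-1)(\xi_n-2)]$. The factorial moments of the immigration are $m_{n,k}=\mathbf{E}[\varepsilon_n(\varepsilon_n-1)\cdots(\varepsilon_n-k+1)]$, $k\in\mathbb{N}$. Conditions: (C1) $\overline{f}_n<1$ for all $n$, $\lim_{n\to\infty}\overline{f}_n=1$, and $\sum_{n=1}^\infty(1-\overline{f}_n)=\infty$. (C2) $\lim_{n\to\infty}\frac{f_n''(1)}{1-\overline{f}_n}=\nu\in[0,\infty)$. (C3) if $\nu>0$, then $\lim_{n\to\infty}\frac{f_n'''(1)}{1-\overline{f}_n}=0$. A random variable $Y$ has a compound-Poisson distribution if it has the law of $\sum_{i=1}^N Z_i$, where $Z_1,Z_2,\ldots$ are iid nonnegative integer-valued and $N$ is Poisson distributed (parameter $0$ allowed) and independent of $(Z_i)$. Its generating function is $f_Y(s)=\mathbf{E}\,s^Y$;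 it is determined by its values on $(0,1]$. Empty sums are $0$. *)

(* Defs.v *)
From HB Require Import structures.
From mathcomp Require Import all_boot all_order all_algebra.
From mathcomp Require Import finmap.
From mathcomp Require Import all_classical all_reals all_analysis.
Import Order.TTheory GRing.Theory Num.Theory.
Import numFieldNormedType.Exports.

Set Implicit Arguments.
Unset Strict Implicit.
Unset Printing Implicit Defensive.

Local Open Scope classical_set_scope.
Local Open Scope ring_scope.

(* Random variables with values in nat: every subset of nat is measurable, so
   events are given by arbitrary sets of integers. *)
Definition mutually_independent (d : measure_display) (T : measurableType d)
    (R : realType) (P : probability T R) (I : choiceType) (D : set I)
    (X : I -> {RV P >-> nat}) : Prop :=
  forall (J : {fset I}) (A : I -> set nat), [set` J] `<=` D ->
    P (\bigcap_(i in [set` J]) (X i @^-1` A i)) =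
    (\prod_(i <- J) P (X i @^-1` A i))%E.

Definition mean (d : measure_display) (T : measurableType d)
    (R : realType) (P : probability T R) (X : {RV P >-> nat}) : \bar R :=
  'E_P[fun w => (X w)%:R].

(* The k-th factorial moment E[X(X-1)...(X-k+1)], possibly +oo; for an
   offspring variable this is the k-th left derivative at 1 of its generating
   function. *)
Definition fact_moment (d : measure_display) (T : measurableType d)
    (R : realType) (P : probability T R) (k : nat) (X : {RV P >-> nat}) :
    \bar R :=
  'E_P[fun w => (X w ^_ k)%:R].

Definition pgf (d : measure_display) (T : measurableType d)
    (R : realType) (P : probability T R) (X : {RV P >-> nat}) (s : R) :
    \bar R :=
  'E_P[fun w => s ^+ X w].

(* Generations and individuals are numbered from 1: the values xi 0 _, xi _ 0
   and eps 0 are never used. *)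
Fixpoint gwvei (T : Type) (xi : nat -> nat -> T -> nat) (eps : nat -> T -> nat)
    (n : nat) (w : T) : nat :=
  if n is m.+1 then
    ((\sum_(1 <= j < (gwvei xi eps m w).+1) xi m.+1 j w) + eps m.+1 w)%N
  else 0%N.

Definition gwvei_index : set (nat * nat + nat) :=
  [set i | match i with
           | inl (n, j) => (0 < n)%N /\ (0 < j)%N
           | inr n => (0 < n)%N
           end].

(* The joint family of all the xi n j (left injection) and eps n (right). *)
Definition gwvei_family (d : measure_display) (T : measurableType d)
    (R : realType) (P : probability T R)
    (xi : nat -> nat -> {RV P >-> nat}) (eps : nat -> {RV P >-> nat})
    (i : nat * nat + nat) : {RV P >-> nat} :=
  match i with
  | inl (n, j) => xi n j
  | inr n => eps n
  end.

(* Convergence in distribution of integer-valued variables, seen as real-valued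
   ones; the limit may live on another probability space. *)
Definition cvg_in_distribution (d d' : measure_display) (T : measurableType d)
    (T' : measurableType d') (R : realType) (P : probability T R)
    (P' : probability T' R) (X : nat -> T -> nat) (Y : T' -> nat) : Prop :=
  forall g : R -> R, continuous g -> (exists M : R, forall x, `|g x| <= M) ->
    'E_P[fun w => g (X n w)%:R]%E @[n --> \oo] --> 'E_P'[fun w => g (Y w)%:R]%E.

(* The index None stands for N, and Some i for the i-th summand. The second
   argument of poisson_prob is a dummy, and poisson_prob 0 is the Dirac measure
   at 0. *)
Definition compound_poisson (d : measure_display) (T : measurableType d)
    (R : realType) (P : probability T R) (Y : {RV P >-> nat}) : Prop :=
  exists (d' : measure_display) (T' : measurableType d') (Q : probability T' R)
    (N : {RV Q >-> nat}) (Z : nat -> {RV Q >-> nat}) (rate : R),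
  [/\ 0 <= rate,
      distribution Q N = poisson_prob rate 0%N,
      forall i, distribution Q (Z i) = distribution Q (Z 0%N),
      mutually_independent setT
        (fun o : option nat => if o is Some i then Z i else N)
    & forall A : set nat,
        P (Y @^-1` A) = Q [set w | A (\sum_(i < N w) Z i w)%N]].

(* The k-th summand of the exponent of the limiting generating function; the
   case nu = 0 is the limit as nu decreases to 0 of the other one. *)
Definition exponent_term (R : realType) (nu : R) (lam : nat -> R) (s : R)
    (k : nat) : R :=
  if nu == 0 then - ((-1) ^+ k * (lam k / k%:R) * (1 - s) ^+ k)
  else 2 ^+ k * lam k / nu ^+ k *
       (ln (1 + nu / 2 * (1 - s)) +
        \sum_(1 <= i < k)
          (-1) ^+ i * (nu ^+ i / (i%:R * 2 ^+ i)) * (1 - s) ^+ i).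

(* Main.v *)
(* Write u = 1 - s, a_n = 1 - E xi_n and h_n(u) = 1 - f_n(1 - u), so that
   0 <= h_n(u) <= (1 - a_n) u. The exponent E of the limit solves
   E'(u) (u + nu u^2 / 2) = sum_k (-1)^(k-1) lam_k u^k. By (C2), (C3) and the
   hypothesis on the factorial moments, both read through the Bonferroni
   inequalities, E(h_n(u)) + (1 - g_n(1 - u)) = E(u) + o(a_n) u, with g_n the
   generating function of eps_n: the recursion G_n(u) = G_{n-1}(h_n(u)) + 1 - g_n(1 - u)
   is an Euler scheme for E. Its errors are damped by the factors 1 - a_k, whose
   product tends to 0, hence G_n -> E; comparing products with exponentials in
   the same way, the generating function of Y_n tends to exp(-E).
   Up to an additive constant, - G_n(1 - s) is a power series in s with nonnegative
   coefficients. Coefficients converge with generating functions, so E(1 - s) =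
   sum_j r_j (1 - s^j) with r_j >= 0 summable, which makes exp(-E) the generating
   function of a compound Poisson law. *)

Require Import Defs.
From HB Require Import structures.
From mathcomp Require Import all_boot all_order all_algebra.
From mathcomp Require Import finmap.
From mathcomp Require Import all_classical all_reals all_analysis.
From mathcomp Require Import measurable_realfun ring lra.
Import Order.TTheory GRing.Theory Num.Theory.
Import numFieldNormedType.Exports.

Local Open Scope classical_set_scope.
Local Open Scope ring_scope.

(** * The recursion and its limit *)

(** The moment hypotheses hold for each fixed order, not uniformly in the order, so the exponent
    series is never handled as a whole: its partial sums of order K are compared with G_n, n tending
    to infinity before K. Their remainder [lam K * u ^+ K] vanishes for u < 1 only, whence the
    exclusion of s = 0 and a separate value of the limit function there. Undamped, the local errors
    would add up to a multiple of the divergent sum of the a_n. They have to be kept linear in u, as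
    small multiples of a_n u, because the contraction of the argument then pays for them exactly.
    The additive recursion G_n is studied beside the generating function H_n of Y_n because
    positivity is visible on it: composition with offspring generating functions and addition of
    immigration ones keep coefficients nonnegative, whereas log H_n need not have nonnegative
    coefficients. The compound Poisson variable is built without infinite products of measures: the
    Poisson number and all summands are read off a single uniform variable. *)

Section stability.
Variables (R : realType) (a : nat -> R) (h : nat -> R -> R).
Hypothesis a01 : forall n, (0 < n)%N -> 0 < a n <= 1.
Hypothesis h_bound : forall n u, (0 < n)%N -> 0 <= u <= 1 ->
  0 <= h n u <= (1 - a n) * u.

Lemma contraction_le n u : (0 < n)%N -> 0 <= u <= 1 -> 0 <= h n u <= u.
Proof.
move=> n0 u01; have /andP[h0 h1] := h_bound _ _ n0 u01.
have /andP[a0 a1] := a01 _ n0; rewrite h0 (le_trans h1)//.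
by move/andP: u01 => [u0 u1]; nra.
Qed.

(** Budget of one step: after moving to [h n.+1 u <= (1 - a n.+1) * u], the old allowance is at most
    [c * (1 - a n.+1) * u], and the new error [a n.+1 * c * u] restores [c * u]. What is left of [D]
    is evaluated at the iterated point [v]. Since [h] contracts, the interval up to [u0] is stable
    and the step estimate is only required there. *)
Lemma stability (D : nat -> R -> R) (n1 : nat) (u0 c : R) :
  u0 <= 1 -> 0 <= c ->
  (forall n u, (n1 <= n)%N -> 0 <= u <= u0 ->
     D n.+1 u <= D n (h n.+1 u) + a n.+1 * c * u) ->
  forall n u, (n1 <= n)%N -> 0 <= u <= u0 ->
  exists2 v, 0 <= v <= \prod_(n1 <= k < n) (1 - a k.+1) * u &
             D n u <= D n1 v + c * u.
Proof.
move=> u01 c0 HD; elim=> [|n IH] u.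
  rewrite leqn0 => /eqP-> /andP[u_ge0 ule]; exists u.
    by rewrite big_geq// mul1r u_ge0 lexx.
  by rewrite lerDl mulr_ge0.
rewrite leq_eqVlt => /orP[/eqP n1E|]; last rewrite ltnS => n1n; move=> /andP[u_ge0 ule].
  exists u; first by rewrite -n1E big_geq// mul1r u_ge0 lexx.
  by rewrite n1E lerDl mulr_ge0.
have u1 : 0 <= u <= 1 by rewrite u_ge0 (le_trans ule).
have /andP[h0 h1] := h_bound n.+1 _ isT u1.
have /andP[a0 a1] := a01 n.+1 isT.
have hu : 0 <= h n.+1 u <= u0.
  by rewrite h0 (le_trans h1)//; nra.
have [v /andP[v0 v1] Dv] := IH _ n1n hu; exists v.
  rewrite v0/= (le_trans v1)// big_nat_recr//= -mulrA ler_wpM2l//.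
  rewrite big_nat_cond prodr_ge0// => k /andP[/andP[_ kn] _].
  by rewrite subr_ge0; have /andP[] := a01 k.+1 isT.
rewrite (le_trans (HD _ _ n1n _))//; first by rewrite u_ge0.
by nra.
Qed.

(** From [1 - x <= expR (- x)]; dropping the first [n1] terms does not affect the divergence. *)
Lemma prod_contraction_cvg0 (n1 : nat) :
  \sum_(0 <= k < n) a k.+1 @[n --> \oo] --> +oo ->
  \prod_(n1 <= k < n) (1 - a k.+1) @[n --> \oo] --> 0.
Proof.
move=> sa.
apply: (@squeeze_cvgr _ _ _ _ (fun=> 0) (fun n => expR (- \sum_(n1 <= k < n) a k.+1))).
- near=> n; apply/andP; split.
    rewrite big_nat_cond prodr_ge0// => k /andP[/andP[_ kn] _].
    by rewrite subr_ge0; have /andP[] := a01 k.+1 isT.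
  rewrite -sumrN expR_sum big_nat_cond [leRHS]big_nat_cond.
  apply: ler_prod => k _; rewrite expR_ge1Dx subr_ge0 andbT.
  by have /andP[] := a01 k.+1 isT.
- exact: cvg_cst.
- have -> : (fun n => expR (- \sum_(n1 <= k < n) a k.+1)) =
     (fun x => expR (- x)) \o (fun n => \sum_(n1 <= k < n) a k.+1) by [].
  apply: (@cvg_comp _ _ _ _ (fun x : R => expR (- x)) _ +oo); last exact: cvgr_expR.
  apply/cvgryPge => A.
  move/cvgryPge/(_ (A + \sum_(0 <= k < n1) a k.+1)) : sa => sa.
  near=> n; have /= : A + \sum_(0 <= k < n1) a k.+1 <= \sum_(0 <= k < n) a k.+1.
    by near: n.
  rewrite (@big_cat_nat _ _ _ n1 0 n)//=; last by near: n; exists n1.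
  by rewrite [leLHS]addrC lerD2l.
Unshelve. all: by end_near. Qed.

End stability.

(** * The exponent, its derivative and a Taylor estimate *)

Section exponent.
Variables (R : realType) (nu : R) (lam : nat -> R).
Hypothesis nu_ge0 : 0 <= nu.
Hypothesis lam_ge0 : forall k, (0 < k)%N -> 0 <= lam k.

Lemma is_derive_monomial (k : nat) (c v : R) :
  is_derive v 1 (fun u : R => c * u ^+ k) (c * (k%:R * v ^+ k.-1)).
Proof.
have H := @is_deriveX R R id k v 1 1 (is_derive_id _ _).
have -> : (fun u : R => c * u ^+ k) = c \*: ((id : R -> R) ^+ k).
  by apply/funext => u; rewrite /= exprfctE.
apply: is_derive_eq.
by rewrite /GRing.scale/= mulr1.
Qed.

Lemma is_derive_sum_nat (m n : nat) (f : nat -> R -> R) (df : nat -> R) (v : R) :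
  (forall k, (m <= k < n)%N -> is_derive v 1 (f k) (df k)) ->
  is_derive v 1 (fun u => \sum_(m <= k < n) f k u) (\sum_(m <= k < n) df k).
Proof.
case: (leqP n m) => [nm _|mn].
  rewrite big_geq//; under eq_fun do rewrite big_geq//.
  exact: is_derive_cst.
elim: n mn => // n IH; rewrite ltnS => mn H.
rewrite big_nat_recr//=; under eq_fun do rewrite big_nat_recr//=.
apply: (@is_deriveD _ _ _ (fun u => \sum_(m <= k < n) f k u)); last first.
  by apply: H; rewrite mn ltnSn.
move: mn; rewrite leq_eqVlt => /orP[/eqP->|mn].
  rewrite big_geq//; under eq_fun do rewrite big_geq//.
  exact: is_derive_cst.
by apply: IH => // k /andP[mk kn]; apply: H; rewrite mk ltnW.
Qed.

(** One formula covers both branches of [exponent_term], so the estimates drawn from it need no case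
    distinction on [nu]. *)
Definition exponent_deriv (k : nat) (v : R) : R :=
  (-1) ^+ k.-1 * lam k * v ^+ k.-1 / (1 + nu / 2 * v).

(** The finite sum in [exponent_term] is minus the Taylor polynomial of the logarithm. Its
    derivative is a finite geometric sum of ratio [- (nu / 2 * v)], which cancels the derivative of
    the logarithm up to the tail of the geometric series. *)
Lemma is_derive_exponent_term (k : nat) (v : R) : (0 < k)%N -> 0 <= v ->
  is_derive v 1 (fun u => exponent_term nu lam (1 - u) k) (exponent_deriv k v).
Proof.
move=> k0 v0; rewrite /exponent_term /exponent_deriv.
have [nu0|nu_neq0] := eqVneq nu 0.
  rewrite (_ : (fun _ => _) = fun u => - ((-1) ^+ k * (lam k / k%:R)) * u ^+ k); last first.
    by apply/funext => u; rewrite opprB addrCA subrr addr0 mulNr.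
  have := is_derive_monomial k (- ((-1) ^+ k * (lam k / k%:R))) v.
  move/is_derive_eq; apply.
  rewrite nu0 !mul0r addr0 divr1 -{1}(prednK k0) exprS.
  by field; rewrite pnatr_eq0 -lt0n.
have dpos : 0 < 1 + nu / 2 * v by rewrite ltr_pwDl// mulr_ge0// divr_ge0.
pose c := 2 ^+ k * lam k / nu ^+ k.
pose L := (fun u => ln (1 + nu / 2 * u)).
pose S := fun u => \sum_(1 <= i < k) (-1) ^+ i * (nu / 2) ^+ i / i%:R * u ^+ i.
rewrite (_ : (fun _ => _) = c \*: (L + S)); last first.
  apply/funext => u; rewrite /= fctE; congr (_ * _).
  rewrite opprB addrCA subrr addr0; congr (_ + _).
  apply: eq_big_nat => i /andP[i0 _]; congr (_ * _).
  rewrite expr_div_n; field.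
  by rewrite pnatr_eq0 -lt0n i0 expf_neq0.
have dL : is_derive v 1 L ((1 + nu / 2 * v)^-1 * (nu / 2)).
  apply: is_derive1_comp; first exact: is_derive1_ln.
  have := is_derive_monomial 1 (nu / 2) v; rewrite /= expr0 mulr1 mulr1 => H.
  have := @is_deriveD _ R R (fun=> 1) (fun u => nu / 2 * u) v 1 0 _ (is_derive_cst _ _ _).
  by move=> /(_ _ H); rewrite add0r.
have dS : is_derive v 1 S (\sum_(1 <= i < k) ((-1) ^+ i * (nu / 2) ^+ i / i%:R * (i%:R *
  v ^+ i.-1))).
  by apply: is_derive_sum_nat => i _; exact: is_derive_monomial.
have H : is_derive v 1 (c \*: (L + S)) (c *: ((1 + nu / 2 * v)^-1 * (nu / 2) + \sum_(1 <=
  i < k) ((-1) ^+ i * (nu / 2) ^+ i / i%:R * (i%:R * v ^+ i.-1)))).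
  by apply: is_deriveZ; apply: is_deriveD.
apply: (is_derive_eq H); rewrite /GRing.scale/=.
have -> : \sum_(1 <= i < k) ((-1) ^+ i * (nu / 2) ^+ i / i%:R * (i%:R * v ^+ i.-1))
  = - (nu / 2) * \sum_(i < k.-1) (- (nu / 2 * v)) ^+ i.
  rewrite big_add1 big_mkord mulr_sumr; apply: eq_bigr => i _ /=.
  rewrite !exprS -[- (_ * v)]mulN1r !exprMn.
  have : i.+1%:R != 0 :> R by rewrite pnatr_eq0.
  by move: (i.+1%:R) => r r0; field.
set y := nu / 2; set x := y * v.
have geo : (1 + x) * (\sum_(i < k.-1) (- x) ^+ i) = 1 - (- x) ^+ k.-1.
  have := subrX1 (- x) k.-1 => E.
  by rewrite -[RHS]opprB E; ring.
have -> : \sum_(i < k.-1) (- x) ^+ i = (1 - (- x) ^+ k.-1) / (1 + x).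
  by rewrite -geo mulrAC divff ?mul1r// lt0r_neq0.
have -> : (- x) ^+ k.-1 = (-1) ^+ k.-1 * (y ^+ k.-1 * v ^+ k.-1).
  by rewrite -[- x]mulN1r !exprMn.
have ck : c * y * y ^+ k.-1 = lam k.
  rewrite -mulrA -exprS prednK// /c /y expr_div_n.
  by field; rewrite !expf_neq0.
rewrite -[in RHS]ck.
field; exact: lt0r_neq0.
Qed.

(** Plays the part of a bound on the second derivative. On [0,1] the power [v ^+ k.-1] is
    k-Lipschitz and the inverse of [1 + nu / 2 * v] is (nu/2)-Lipschitz, hence the constant. *)
Lemma exponent_deriv_lipschitz (k : nat) : (0 < k)%N ->
  exists2 M, 0 <= M & forall u v, 0 <= u <= 1 -> 0 <= v <= 1 ->
    `|exponent_deriv k u - exponent_deriv k v| <= M * `|u - v|.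
Proof.
move=> k0; exists (lam k * (k%:R + nu / 2)).
  by rewrite mulr_ge0 ?lam_ge0// addr_ge0// divr_ge0.
move=> u v /andP[u0 u1] /andP[v0 v1].
have y0 : 0 <= nu / 2 by rewrite divr_ge0.
have du : 1 <= 1 + nu / 2 * u by rewrite lerDl mulr_ge0.
have dv : 1 <= 1 + nu / 2 * v by rewrite lerDl mulr_ge0.
have du0 : 0 < 1 + nu / 2 * u by rewrite (lt_le_trans _ du).
have dv0 : 0 < 1 + nu / 2 * v by rewrite (lt_le_trans _ dv).
rewrite /exponent_deriv.
have -> : (-1) ^+ k.-1 * lam k * u ^+ k.-1 / (1 + nu / 2 * u) -
   (-1) ^+ k.-1 * lam k * v ^+ k.-1 / (1 + nu / 2 * v) =
   (-1) ^+ k.-1 * (lam k * ((u ^+ k.-1 - v ^+ k.-1) / (1 + nu / 2 * u) +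
     v ^+ k.-1 * (nu / 2) * (v - u) / ((1 + nu / 2 * u) * (1 + nu / 2 * v)))).
  by field; rewrite !gt_eqF// ltr_pwDl// mulr_ge0.
rewrite normrM normrX normrN1 expr1n mul1r normrM (ger0_norm (lam_ge0 k k0)) -[leRHS]mulrA.
rewrite ler_wpM2l ?lam_ge0// (le_trans (ler_normD _ _))// [leRHS]mulrDl lerD//.
  rewrite normrM normfV (gtr0_norm du0) ler_pdivrMr// -[leLHS]mulr1.
  rewrite ler_pM//= subrXX normrM mulrC ler_wpM2r//.
  rewrite (le_trans (ler_norm_sum _ _ _))//.
  rewrite (@le_trans _ _ (\sum_(i < k.-1) 1))//; last first.
    by rewrite sumr_const card_ord ler_nat leq_pred.
  apply: ler_sum => i _; rewrite normrM !normrX !ger0_norm//.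
  by rewrite mulr_ile1 ?exprn_ge0 ?exprn_ile1.
rewrite normrM normfV (gtr0_norm (mulr_gt0 du0 dv0)) ler_pdivrMr ?mulr_gt0// normrM [X in
  X * _]normrM.
rewrite normrX (ger0_norm v0) (ger0_norm y0) distrC -[leLHS]mulr1.
rewrite ler_pM ?mulr_ge0 ?exprn_ge0//.
  by rewrite ler_wpM2r// -[leRHS]mul1r ler_wpM2r// exprn_ile1.
exact: mulr_ege1.
Qed.

(** Mean value theorem with a Lipschitz derivative. The constant depends on [K], which is harmless
    since [K] is fixed before n tends to infinity. *)
Lemma exponent_sum_taylor (K : nat) : exists2 M, 0 <= M &
  forall u v, 0 <= v <= u -> u <= 1 ->
  `|\sum_(1 <= k < K) exponent_term nu lam (1 - u) k
    - \sum_(1 <= k < K) exponent_term nu lam (1 - v) k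
    - (\sum_(1 <= k < K) exponent_deriv k u) * (u - v)| <= M * (u - v) ^+ 2.
Proof.
have [M M0 HM] : exists2 M, 0 <= M & forall u v, 0 <= u <= 1 -> 0 <= v <= 1 ->
    `|\sum_(1 <= k < K) exponent_deriv k u - \sum_(1 <= k < K) exponent_deriv k v|
      <= M * `|u - v|.
  elim: K => [|K [M M0 HM]].
    by exists 0 => // u v _ _; rewrite !big_geq// subrr normr0 mul0r.
  case: (posnP K) => [->|K0].
    by exists 0 => // u v _ _; rewrite !big_geq// subrr normr0 mul0r.
  have [M' M'0 HM'] := exponent_deriv_lipschitz _ K0.
  exists (M + M'); first exact: addr_ge0.
  move=> u v u01 v01; rewrite !big_nat_recr//= opprD addrACA mulrDl.
  by rewrite (le_trans (ler_normD _ _))// lerD ?HM ?HM'.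
exists M => // u v /andP[v0 vu] u1.
have D (w : R) : 0 <= w -> is_derive w 1
    (fun x => \sum_(1 <= k < K) exponent_term nu lam (1 - x) k)
    (\sum_(1 <= k < K) exponent_deriv k w).
  by move=> w0; apply: is_derive_sum_nat => k /andP[k0 _]; exact: is_derive_exponent_term.
have [||c] := @MVT_segment R (fun x => \sum_(1 <= k < K) exponent_term nu lam (1 - x) k)
    (fun w => \sum_(1 <= k < K) exponent_deriv k w) _ _ vu.
- by move=> x; rewrite in_itv/= => /andP[vx _]; apply: D; rewrite (le_trans v0)// ltW.
- apply: derivable_within_continuous => x; rewrite in_itv/= => /andP[vx _].
  by have [] := D x (le_trans v0 vx).
rewrite in_itv/= => /andP[vc cu] ->.
rewrite -mulrBl normrM (ger0_norm (x := u - v)) ?subr_ge0// expr2 mulrA.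
rewrite ler_wpM2r ?subr_ge0//.
have c01 : 0 <= c <= 1 by rewrite (le_trans v0)//= (le_trans cu).
have u01 : 0 <= u <= 1 by rewrite (le_trans v0)//= (le_trans vc).
rewrite (le_trans (HM _ _ c01 u01))// ler_wpM2l// distrC ger0_norm ?subr_ge0//.
by rewrite lerD2l lerN2.
Qed.

End exponent.

(** * Convergence of the additive and multiplicative recursions *)

Section limit.
Variables (R : realType) (nu : R) (lam : nat -> R) (a : nat -> R).
Variables (h q : nat -> R -> R).
Hypothesis nu_ge0 : 0 <= nu.
Hypothesis lam_ge0 : forall k, (0 < k)%N -> 0 <= lam k.
Hypothesis a01 : forall n, (0 < n)%N -> 0 < a n <= 1.
Hypothesis a_cvg0 : a n @[n --> \oo] --> 0.
Hypothesis sum_a : \sum_(0 <= k < n) a k.+1 @[n --> \oo] --> +oo.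
Hypothesis h_bound : forall n u, (0 < n)%N -> 0 <= u <= 1 ->
  0 <= h n u <= (1 - a n) * u.
Hypothesis h_expansion : forall e, 0 < e -> \forall n \near \oo,
  forall u, 0 <= u <= 1 ->
  `|u - h n u - a n * (u + nu / 2 * u ^+ 2)| <= e * a n * u.
Hypothesis q_expansion : forall K e, (0 < K)%N -> 0 < e -> \forall n \near \oo,
  forall u, 0 <= u <= 1 ->
  `|q n u - a n * \sum_(1 <= k < K) (-1) ^+ k.-1 * lam k * u ^+ k|
    <= a n * (lam K * u ^+ K + e * u).

Let Esum K u := \sum_(1 <= k < K) exponent_term nu lam (1 - u) k.
Let Dsum K u := \sum_(1 <= k < K) exponent_deriv _ nu lam k u.

Lemma exponent_term0 k : (0 < k)%N -> exponent_term nu lam 1 k = 0.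
Proof.
move=> k0; rewrite /exponent_term subrr expr0n gtn_eqF//= !mulr0 oppr0 addr0 ln1.
case: ifP => // _; rewrite add0r big_nat_cond big1 ?mulr0// => i /andP[/andP[i0 _] _].
by rewrite expr0n gtn_eqF// mulr0.
Qed.

Lemma exponent_deriv_sum_bound K : exists2 M, 0 <= M &
  forall u, 0 <= u <= 1 -> `|Dsum K u| <= M.
Proof.
exists (\sum_(1 <= k < K) lam k).
  by rewrite big_nat_cond sumr_ge0// => k /andP[/andP[k0 _] _]; exact: lam_ge0.
move=> u /andP[u0 u1]; rewrite (le_trans (ler_norm_sum _ _ _))//.
rewrite big_nat_cond [leRHS]big_nat_cond.
apply: ler_sum => k /andP[/andP[k0 _] _].
have d1 : 1 <= 1 + nu / 2 * u by rewrite lerDl mulr_ge0// divr_ge0.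
rewrite normrM normfV (ger0_norm (le_trans ler01 d1)) ler_pdivrMr ?(lt_le_trans ltr01)//.
rewrite 2!normrM normrX normrN1 expr1n mul1r normrX (ger0_norm u0) (ger0_norm (lam_ge0 _
  k0)).
by rewrite ler_wpM2l ?lam_ge0// (le_trans _ d1)// exprn_ile1.
Qed.

(** Linear decay at u = 0 is what lets the vanishing product of the factors [1 - a k] kill the
    initial error of the scheme. *)
Lemma exponent_sum_bound K : exists2 M, 0 <= M &
  forall u, 0 <= u <= 1 -> `|Esum K u| <= M * u.
Proof.
have [M1 M10 HM1] := exponent_sum_taylor _ nu lam nu_ge0 lam_ge0 K.
have [M2 M20 HM2] := exponent_deriv_sum_bound K.
exists (M1 + M2); first exact: addr_ge0.
move=> u /andP[u0 u1].
have := HM1 u 0; rewrite lexx u0 !subr0 => /(_ isT u1).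
rewrite [X in _ - X - _]big_nat_cond [X in _ - X - _]big1; last first.
  by move=> k /andP[/andP[k0 _] _]; rewrite exponent_term0.
rewrite subr0 -/(Esum K u) -/(Dsum K u) => H.
have -> : Esum K u = (Esum K u - Dsum K u * u) + Dsum K u * u by rewrite subrK.
rewrite (le_trans (ler_normD _ _))// mulrDl lerD//.
  by rewrite (le_trans H)// ler_wpM2l// expr2 ler_piMr.
by rewrite normrM (ger0_norm u0) ler_wpM2r// HM2// u0.
Qed.

(** The differential equation of the exponent, in truncated form: [u + nu / 2 * u ^+ 2] is u times
    the denominator of [exponent_deriv]. *)
Lemma exponent_deriv_sumE K u : 0 <= u ->
  Dsum K u * (u + nu / 2 * u ^+ 2) =
  \sum_(1 <= k < K) (-1) ^+ k.-1 * lam k * u ^+ k.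
Proof.
move=> u0; rewrite mulr_suml; apply: eq_big_nat => k /andP[k0 _].
rewrite /exponent_deriv -[in X in _ = _ * X](prednK k0) [in RHS]exprS.
by field; rewrite gt_eqF// ltr_pwDl// mulr_ge0.
Qed.

(* Since E' (u + nu u^2 / 2) = sum (-1)^(k-1) lam_k u^k, the decrease of E along
   h n cancels q n to first order in a n. *)
Lemma exponent_consistency K u0 e : (0 < K)%N -> 0 <= u0 <= 1 -> 0 < e ->
  \forall n \near \oo, forall u, 0 <= u <= u0 ->
  `|Esum K u - Esum K (h n u) - q n u| <=
    a n * (lam K * u0 ^+ K.-1 + e) * u.
Proof.
move=> K0 /andP[u00 u01] e0.
have [M M0 HM] := exponent_sum_taylor _ nu lam nu_ge0 lam_ge0 K.
have [B B0 HB] := exponent_deriv_sum_bound K.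
(* The tolerance is split in three: Taylor remainder, expansion of [h] multiplied by the derivative,
   expansion of [q]. The derivative is at most [B], hence the division by [B + 1]. *)
pose e1 := e / 3 / (B + 1).
have B1 : 0 < B + 1 by rewrite ltr_wpDl.
have e10 : 0 < e1 by rewrite !divr_gt0.
(* [C * a n * u] will bound [u - h n u], and [M1] turns the smallness of [a n] into
   [M * C ^+ 2 * a n <= e / 3]. *)
pose C := 1 + nu / 2 + e1.
have C0 : 0 <= C by rewrite !addr_ge0// ?divr_ge0// ltW.
pose M1 := M * C ^+ 2 + 1.
have M10 : 0 < M1 by rewrite ltr_wpDl// mulr_ge0// exprn_ge0.
have e30 : 0 < e / 3 by rewrite divr_gt0.
have e40 : 0 < e / 3 / M1 by rewrite divr_gt0.
move/cvgrPdist_le : a_cvg0 => /(_ _ e40) a_small.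
near=> n => u /andP[u_ge0 ule].
have n0 : (0 < n)%N by near: n; exists 1%N.
have u1 : u <= 1 by rewrite (le_trans ule).
have uI : 0 <= u <= 1 by rewrite u_ge0.
have /andP[a0 a1] := a01 _ n0.
have h_e : `|u - h n u - a n * (u + nu / 2 * u ^+ 2)| <= e1 * a n * u.
  by move: u uI {u_ge0 ule u1}; near: n; exact: h_expansion.
have q_e : `|q n u - a n * \sum_(1 <= k < K) (-1) ^+ k.-1 * lam k * u ^+ k|
    <= a n * (lam K * u ^+ K + e / 3 * u).
  by move: u uI {u_ge0 ule u1 h_e}; near: n; exact: q_expansion.
have ae : a n <= e / 3 / M1.
  have : `|0 - a n| <= e / 3 / M1 by near: n.
  by rewrite sub0r normrN gtr0_norm.
have /andP[h0 hu] := contraction_le _ _ _ a01 h_bound _ _ n0 uI.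
have b0 : 0 <= u - h n u by rewrite subr_ge0.
have bC : u - h n u <= C * a n * u.
  have := le_trans (ler_norm _) h_e; rewrite lerBlDr => /le_trans; apply.
  have u2 : u ^+ 2 <= u by rewrite expr2 ler_piMr.
  rewrite -[C * _]mulrC -[_ * C * _]mulrA /C.
  rewrite [e1 * _]mulrC -[_ * e1 * _]mulrA -mulrDr ler_wpM2l ?(ltW a0)//.
  rewrite 2!mulrDl mul1r addrC lerD2r lerD2l ler_wpM2l//.
  by rewrite divr_ge0.
(* The remainder is quadratic in [a n]; one of the two factors absorbs the constants. *)
have T1 : `|Esum K u - Esum K (h n u) - Dsum K u * (u - h n u)| <= e / 3 * a n * u.
  rewrite (le_trans (HM _ _ _ _))// ?h0//.
  apply: (@le_trans _ _ (M * (C * a n * u) ^+ 2)).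
    by rewrite ler_wpM2l// lerXn2r// nnegrE// !mulr_ge0// ltW.
  have -> : M * (C * a n * u) ^+ 2 = (M * C ^+ 2 * a n) * (a n) * (u * u) by ring.
  have : M * C ^+ 2 * a n <= e / 3.
    rewrite ler_pdivlMr// in ae; rewrite (le_trans _ ae)// mulrC ler_wpM2l ?(ltW a0)//.
    by rewrite lerDl.
  move=> X; rewrite ler_pM ?mulr_ge0 ?exprn_ge0 ?(ltW a0)//.
    by rewrite ler_wpM2r// ltW.
  by rewrite ler_piMr.
have T2 : `|Dsum K u * (u - h n u) - a n * \sum_(1 <= k < K) (-1) ^+ k.-1 * lam k * u ^+ k|
    <= e / 3 * a n * u.
  rewrite -exponent_deriv_sumE// mulrCA -mulrBr normrM.
  apply: (@le_trans _ _ (B * (e1 * a n * u))); first by rewrite ler_pM// HB.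
  have : B * e1 <= e / 3.
    by rewrite mulrCA ler_piMr ?(ltW e30)// ler_pdivrMr// mul1r lerDl.
  move=> Be; rewrite [leLHS](_ : _ = (B * e1) * (a n * u)); last by ring.
  by rewrite -[leRHS]mulrA ler_wpM2r// mulr_ge0// ltW.
(* One factor u is kept, since [stability] requires errors linear in u; the others are bounded by
   [u0]. *)
have T3 : lam K * u ^+ K <= lam K * u0 ^+ K.-1 * u.
  have -> : u ^+ K = u ^+ K.-1 * u by rewrite -exprSr prednK.
  rewrite mulrA ler_wpM2r// ler_wpM2l ?lam_ge0//.
  by rewrite lerXn2r.
set S := \sum_(1 <= k < K) _ in q_e T2.
have -> : Esum K u - Esum K (h n u) - q n u =
   (Esum K u - Esum K (h n u) - Dsum K u * (u - h n u)) +
   (Dsum K u * (u - h n u) - a n * S) - (q n u - a n * S) by ring.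
rewrite (le_trans (ler_normB _ _))// (le_trans (lerD (ler_normD _ _) (lexx _)))//.
apply: (le_trans (lerD (lerD T1 T2) q_e)).
have : a n * (lam K * u ^+ K) <= a n * (lam K * u0 ^+ K.-1 * u) by rewrite ler_wpM2l// ltW.
set X := a n * (lam K * u ^+ K); set Y := a n * _; move=> XY.
have -> : e / 3 * a n * u + e / 3 * a n * u + a n * (lam K * u ^+ K + e / 3 * u) =
  X + e * a n * u by rewrite /X; field.
have -> : a n * (lam K * u0 ^+ K.-1 + e) * u = Y + e * a n * u by rewrite /Y; ring.
by rewrite lerD2r.
Unshelve. all: by end_near. Qed.

Variables (G H : nat -> R -> R) (n0 : nat) (C : R).
Hypothesis lam_small : forall u, 0 <= u < 1 -> lam k * u ^+ k @[k --> \oo] --> 0.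
Hypothesis C_ge0 : 0 <= C.
Hypothesis q_bound : forall n u, (n0 < n)%N -> 0 <= u <= 1 ->
  0 <= q n u <= C * a n * u.
Hypothesis q_le1 : forall n u, (n0 < n)%N -> 0 <= u <= 1 -> q n u <= 1.
Hypothesis G_init : forall u, G n0 u = 0.
Hypothesis G_rec : forall n u, (n0 <= n)%N -> 0 <= u <= 1 ->
  G n.+1 u = G n (h n.+1 u) + q n.+1 u.
Hypothesis H_cont : forall n e, 0 < e -> exists2 d, 0 < d &
  forall u, 0 <= u <= 1 -> u <= d -> `|H n u - 1| <= e.
Hypothesis H_rec : forall n u, 0 <= u <= 1 ->
  H n.+1 u = H n (h n.+1 u) * (1 - q n.+1 u).

(** Contributions whose sizes have a divergent sum stay bounded thanks to the damping:
    [C * (1 - a n) * u + C * a n * u = C * u]. *)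
Lemma additive_recursion_bound n u : (n0 <= n)%N -> 0 <= u <= 1 -> 0 <= G n u <= C * u.
Proof.
elim: n u => [|n IH] u; last rewrite leq_eqVlt => /orP[/eqP n0E|].
- by rewrite leqn0 => /eqP n00; move=> /andP[u0 _]; rewrite -[X in G X]n00 G_init lexx/=
  mulr_ge0.
- by move=> /andP[u0 _]; rewrite -n0E G_init lexx/= mulr_ge0.
rewrite ltnS => n0n u01; rewrite G_rec//.
have /andP[q0 q1] := q_bound n.+1 _ n0n u01.
have /andP[h0 h1] := h_bound n.+1 _ isT u01.
have /andP[h0' h1'] := contraction_le _ _ _ a01 h_bound n.+1 _ isT u01.
have hu : 0 <= h n.+1 u <= 1 by rewrite h0 (le_trans h1')//; move/andP: u01 => [].
have /andP[G0 G1] := IH _ n0n hu.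
rewrite addr_ge0//= (le_trans (lerD G1 q1))// -mulrA -mulrDr ler_wpM2l//.
by rewrite (le_trans (lerD h1 (lexx _)))// mulrBl mul1r subrK.
Qed.

(* Stopping at K uses finitely many moments only, and the Bonferroni remainder
   lam K * u ^+ K, which tends to 0, makes the partial sums Cauchy. *)
Lemma additive_recursion_dist K u e : (0 < K)%N -> 0 <= u <= 1 -> 0 < e ->
  \forall n \near \oo, `|G n u - Esum K u| <= lam K * u ^+ K + e.
Proof.
move=> K0 /andP[u0 u1] e0; have e20 : 0 < e / 2 by rewrite divr_gt0.
have uI : 0 <= u <= 1 by rewrite u0.
have [B B0 HB] := exponent_sum_bound K.
have [n1 _ Hn1] := exponent_consistency _ _ _ K0 uI e20.
(* The recursion of [G] starts at [n0], the consistency estimate at [n1]. *)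
pose n2 := maxn n0 n1.
have cge0 : 0 <= lam K * u ^+ K.-1 + e / 2.
  by rewrite addr_ge0 ?(ltW e20)// mulr_ge0 ?lam_ge0 ?exprn_ge0.
have step n v : (n2 <= n)%N -> 0 <= v <= u ->
    `|G n.+1 v - Esum K v| <= `|G n (h n.+1 v) - Esum K (h n.+1 v)| +
       a n.+1 * (lam K * u ^+ K.-1 + e / 2) * v.
  rewrite geq_max => /andP[n0n n1n] vu.
  have vI : 0 <= v <= 1 by case/andP: vu => -> vu; rewrite (le_trans vu).
  have := Hn1 n.+1 (leqW n1n) _ vu; rewrite -normrN => X.
  rewrite G_rec//.
  have -> : G n (h n.+1 v) + q n.+1 v - Esum K v = (G n (h n.+1 v) - Esum K (h n.+1 v))
    + - (Esum K v - Esum K (h n.+1 v) - q n.+1 v) by ring.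
  by rewrite (le_trans (ler_normD _ _))// lerD2l.
have P0 := prod_contraction_cvg0 _ _ a01 n2 sum_a.
(* At the end of the iteration the difference left over is at most [(C + B) * v], with [v] below the
   vanishing product. *)
have CB0 : 0 < C + B + 1 by rewrite ltr_wpDl// addr_ge0.
have : 0 < e / 2 / (C + B + 1) by rewrite divr_gt0.
move/cvgrPdist_le : P0 => /[apply] P0.
near=> n.
have n2n : (n2 <= n)%N by near: n; exists n2.
have uu : 0 <= u <= u by rewrite u0 lexx.
have [v /andP[v0 vP] Gv] := stability _ _ _ a01 h_bound
  (fun n v => `|G n v - Esum K v|) _ _ _ u1 cge0 step _ _ n2n uu.
have vI : 0 <= v <= 1.
  rewrite v0 (le_trans vP)// mulr_ile1//.
    rewrite big_nat_cond prodr_ge0// => k _.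
    by rewrite subr_ge0; have /andP[] := a01 k.+1 isT.
  rewrite big_nat_cond prodr_ile1// => k _.
  by have /andP[k0 k1] := a01 k.+1 isT; rewrite subr_ge0 k1 gerBl ltW.
apply: (le_trans Gv).
rewrite mulrDl -mulrA -exprSr prednK// addrCA lerD2l.
rewrite [leRHS](splitr e) addrC lerD//.
  by rewrite ler_piMr// ltW.
have /andP[G0 G1] := additive_recursion_bound n2 v (leq_maxl _ _) vI.
apply: (@le_trans _ _ ((C + B) * v)).
  rewrite (le_trans (ler_normB _ _))// mulrDl lerD//; first by rewrite ger0_norm.
  exact: HB.
apply: (@le_trans _ _ ((C + B) * \prod_(n2 <= k < n) (1 - a k.+1))).
  rewrite ler_wpM2l ?addr_ge0// (le_trans vP)// ler_piMr//.
  rewrite big_nat_cond prodr_ge0// => k _.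
  by rewrite subr_ge0; have /andP[] := a01 k.+1 isT.
have : `|0 - \prod_(n2 <= k < n) (1 - a k.+1)| <= e / 2 / (C + B + 1) by near: n.
rewrite sub0r normrN => /(le_trans (ler_norm _)).
rewrite ler_pdivlMr// => /(le_trans _); apply; rewrite mulrC ler_wpM2l//.
  rewrite big_nat_cond prodr_ge0// => k _.
  by rewrite subr_ge0; have /andP[] := a01 k.+1 isT.
by rewrite lerDl.
Unshelve. all: by end_near. Qed.

(** Both partial sums are close to the same [G n u] for large n, so the series converges without any
    estimate of its terms. *)
Lemma exponent_sum_dist K L u : (0 < K)%N -> (0 < L)%N -> 0 <= u <= 1 ->
  `|Esum K u - Esum L u| <= lam K * u ^+ K + lam L * u ^+ L.
Proof.
move=> K0 L0 u01; apply/ler_addgt0Pr => e e0.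
have e20 : 0 < e / 2 by rewrite divr_gt0.
near \oo => n.
have HK : `|G n u - Esum K u| <= lam K * u ^+ K + e / 2.
  by near: n; exact: additive_recursion_dist.
have HL : `|G n u - Esum L u| <= lam L * u ^+ L + e / 2.
  by near: n; exact: additive_recursion_dist.
have -> : Esum K u - Esum L u = (G n u - Esum L u) - (G n u - Esum K u) by ring.
rewrite (le_trans (ler_normB _ _))// (le_trans (lerD HL HK))//.
by rewrite addrACA -splitr lerD2r addrC.
Unshelve. all: by end_near. Qed.

Lemma exponent_sum_cvg u : 0 <= u < 1 -> cvgn (Esum ^~ u).
Proof.
move=> u01; apply/cauchy_cvgP; apply: cauchy_exP => e e0.
have e20 : 0 < e / 3 by rewrite divr_gt0.
move/cvgrPdist_le : (lam_small _ u01) => /(_ _ e20)[N _ HN'].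
have HN n : (N <= n)%N -> `|0 - lam n * u ^+ n| <= e / 3 by exact: HN'.
have uI : 0 <= u <= 1 by move/andP: u01 => [-> /ltW].
exists (Esum N.+1 u); exists N.+1 => // n /= Nn; rewrite -ball_normE/=.
have n0' : (0 < n)%N by apply: leq_trans Nn.
rewrite (le_lt_trans (exponent_sum_dist _ _ _ (ltn0Sn N) n0' uI))//.
have := HN N.+1 (leqnSn N); have := HN n (ltnW Nn); rewrite !sub0r !normrN.
move=> /(le_trans (ler_norm _)) A1 /(le_trans (ler_norm _)) A2.
by rewrite (le_lt_trans (lerD A2 A1))//; lra.
Qed.

Lemma exponent_sum_lim_dist K u : (0 < K)%N -> 0 <= u < 1 ->
  `|Esum K u - limn (Esum ^~ u)| <= lam K * u ^+ K.
Proof.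
move=> K0 u01; apply/ler_addgt0Pr => e e0.
have uI : 0 <= u <= 1 by move/andP: u01 => [-> /ltW].
have e20 : 0 < e / 2 by rewrite divr_gt0.
near \oo => n.
have n0' : (0 < n)%N by near: n; exists 1%N.
have H1 : `|limn (Esum ^~ u) - Esum n u| <= e / 2.
  by near: n; move/cvgrPdist_le : (exponent_sum_cvg _ u01); exact.
have H2 : `|0 - lam n * u ^+ n| <= e / 2.
  by near: n; move/cvgrPdist_le : (lam_small _ u01); exact.
rewrite sub0r normrN in H2; move/(le_trans (ler_norm _)) : H2 => H2.
have -> : Esum K u - limn (Esum ^~ u) = (Esum K u - Esum n u) - (limn (Esum ^~ u) - Esum
  n u).
  by ring.
rewrite (le_trans (ler_normB _ _))//.
rewrite (le_trans (lerD (exponent_sum_dist _ _ _ K0 n0' uI) H1))//.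
by rewrite -addrA lerD2l; lra.
Unshelve. all: by end_near. Qed.

Lemma additive_recursion_cvg u : 0 <= u < 1 -> G n u @[n --> \oo] --> limn (Esum ^~ u).
Proof.
move=> u01; apply/cvgrPdist_le => e e0.
have uI : 0 <= u <= 1 by move/andP: u01 => [-> /ltW].
have e30 : 0 < e / 3 by rewrite divr_gt0.
(* [K] must come first: the rank from which [G n u] is near the partial sum depends on it. *)
near \oo => K.
have K0 : (0 < K)%N by near: K; exists 1%N.
have H2 : `|0 - lam K * u ^+ K| <= e / 3.
  by near: K; move/cvgrPdist_le : (lam_small _ u01); exact.
rewrite sub0r normrN in H2; move/(le_trans (ler_norm _)) : H2 => H2.
near=> n.
have H3 : `|G n u - Esum K u| <= lam K * u ^+ K + e / 3.
  by near: n; exact: additive_recursion_dist.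
have H4 := exponent_sum_lim_dist _ _ K0 u01.
have -> : limn (Esum ^~ u) - G n u = - (G n u - Esum K u) - (Esum K u - limn (Esum ^~ u)).
  by ring.
rewrite (le_trans (ler_normB _ _))// normrN (le_trans (lerD H3 H4))//; lra.
Unshelve. all: by end_near. Qed.

(** The sign of the limit cannot be read off an alternating series; it is inherited from [G]. The
    upper bound is the remainder estimate for the empty partial sum, at order 1. *)
Lemma exponent_lim_bound u : 0 <= u < 1 -> 0 <= limn (Esum ^~ u) <= lam 1 * u.
Proof.
move=> u01; apply/andP; split.
  rewrite -(cvg_lim _ (additive_recursion_cvg _ u01))//.
  apply: limr_ge; first by apply/cvg_ex; exists (limn (Esum ^~ u)); exact:
    additive_recursion_cvg.
  near=> n; have n0n : (n0 <= n)%N by near: n; exists n0.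
  have uI : 0 <= u <= 1 by move/andP: u01 => [-> /ltW].
  by have /andP[] := additive_recursion_bound n u n0n uI.
have := exponent_sum_lim_dist 1 _ isT u01.
by rewrite /Esum big_geq// sub0r normrN expr1 => /(le_trans (ler_norm _)).
Unshelve. all: by end_near. Qed.

(** [expR (- G)] satisfies the recursion of [H] with the factor [1 - y] replaced by [expR (- y)],
    where y is the value of [q]. The two factors differ by at most [y ^+ 2], hence by at most
    [(C * a n * u) ^+ 2], which is a small multiple of [a n * u]: [stability] applies again. *)
Lemma multiplicative_recursion_cvg u : 0 <= u < 1 ->
  H n u @[n --> \oo] --> expR (- limn (Esum ^~ u)).
Proof.
move=> u01.
have uI : 0 <= u <= 1 by move/andP: u01 => [-> /ltW].
suff D0 : H n u - expR (- G n u) @[n --> \oo] --> 0.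
  have E : expR (- G n u) @[n --> \oo] --> expR (- limn (Esum ^~ u)).
    apply: continuous_cvg; first exact: continuous_expR.
    by apply: cvgN; exact: additive_recursion_cvg.
  have -> : H ^~ u = (fun n => (H n u - expR (- G n u)) + expR (- G n u)).
    by apply/funext => n; rewrite subrK.
  by rewrite -[X in _ --> X]add0r; exact: cvgD.
apply/cvgrPdist_le => e e0.
have e40 : 0 < e / 4 by rewrite divr_gt0.
(* Once [a n] is below this bound, [C ^+ 2 * a n <= e / 4]. *)
have e50 : 0 < e / 4 / (C ^+ 2 + 1) by rewrite divr_gt0// ltr_wpDl// exprn_ge0.
move/cvgrPdist_le : a_cvg0 => /(_ _ e50)[n1 _ Hn1].
pose n2 := maxn n0 n1.
have step n v : (n2 <= n)%N -> 0 <= v <= 1 ->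
    `|H n.+1 v - expR (- G n.+1 v)| <= `|H n (h n.+1 v) - expR (- G n (h n.+1 v))| +
       a n.+1 * (e / 4) * v.
  rewrite geq_max => /andP[n0n n1n] vI.
  have /andP[h0 h1] := contraction_le _ _ _ a01 h_bound n.+1 _ isT vI.
  have /andP[v0 v1] := vI.
  have hI : 0 <= h n.+1 v <= 1 by rewrite h0 (le_trans h1).
  have := q_bound n.+1 v n0n vI; have := q_le1 n.+1 v n0n vI.
  have := Hn1 n.+1 (leqW n1n) => /=; rewrite sub0r normrN => /(le_trans (ler_norm _)).
  have /andP[G0 _] := additive_recursion_bound _ _ n0n hI.
  have /andP[a0 _] := a01 n.+1 isT.
  rewrite G_rec// H_rec//.
  move: (q n.+1 v) (a n.+1) a0 (h n.+1 v) G0 {h0 h1 hI} => y b b0 w G0 Hb y1 /andP[y0 yC].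
  rewrite opprD expRD.
  have -> : H n w * (1 - y) - expR (- G n w) * expR (- y) =
    (H n w - expR (- G n w)) * (1 - y) - expR (- G n w) * (expR (- y) - (1 - y)) by ring.
  rewrite (le_trans (ler_normB _ _))// lerD//.
    by rewrite normrM ler_piMr// ger0_norm ?subr_ge0// gerBl.
  have E1 : 1 - y <= expR (- y) by exact: expR_ge1Dx.
  (* Follows from [expR (- y) <= (1 + y)^-1] and [(y ^+ 2 + (1 - y)) * (1 + y) = 1 + y ^+ 3]. *)
  have E2 : expR (- y) - (1 - y) <= y ^+ 2.
    have y10 : 0 < 1 + y by rewrite ltr_pwDl.
    have : expR (- y) <= (1 + y)^-1.
      by rewrite expRN lef_pV2 ?posrE ?expR_gt0// expR_ge1Dx.
    rewrite lerBlDr => /le_trans; apply.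
    rewrite -[leLHS]mul1r ler_pdivrMr//.
    have : 0 <= y ^+ 3 by rewrite exprn_ge0.
    have -> : (y ^+ 2 + (1 - y)) * (1 + y) = 1 + y ^+ 3 by ring.
    by rewrite lerDl.
  rewrite normrM (ger0_norm (expR_ge0 _)) ger0_norm ?subr_ge0//.
  apply: (@le_trans _ _ (1 * y ^+ 2)).
    by rewrite ler_pM ?subr_ge0 ?expR_ge0// -expR0 ler_expR oppr_le0.
  rewrite mul1r.
  apply: (@le_trans _ _ ((C * b * v) ^+ 2)).
    by rewrite lerXn2r// nnegrE !mulr_ge0// ltW.
  have -> : (C * b * v) ^+ 2 = b * (C ^+ 2 * b) * (v * v) by ring.
  rewrite ler_pM ?mulr_ge0 ?exprn_ge0 ?(ltW b0)//; last by rewrite ler_piMr.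
  rewrite ler_wpM2l ?(ltW b0)//.
  move: Hb; rewrite ler_pdivlMr ?ltr_wpDl ?exprn_ge0// => /(le_trans _); apply.
  by rewrite mulrC ler_wpM2l ?(ltW b0)// lerDl.
have P0 := prod_contraction_cvg0 _ _ a01 n2 sum_a.
have [d d0 Hd] := H_cont n2 _ e40.
(* Below [d] the value of [H n2] is within e/4 of 1; below the second bound so is [expR (- G n2)].
   For [H n2] only continuity at u = 0 is at hand, since the first immigration variables may have
   infinite mean. *)
pose d' := Num.min d (e / 4 / (C + 1)).
have C1 : 0 < C + 1 by rewrite ltr_wpDl.
have d'0 : 0 < d' by rewrite lt_min d0 divr_gt0.
move/cvgrPdist_le : P0 => /(_ _ d'0) P0.
near=> n.
have n2n : (n2 <= n)%N by near: n; exists n2.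
have [v /andP[v0 vP] Hv] := stability _ _ _ a01 h_bound
  (fun n v => `|H n v - expR (- G n v)|) _ _ _ (lexx 1) (ltW e40) step _ _ n2n uI.
have /andP[u0 u1] := uI.
have vI : 0 <= v <= 1.
  rewrite v0 (le_trans vP)// mulr_ile1//.
    rewrite big_nat_cond prodr_ge0// => k _.
    by rewrite subr_ge0; have /andP[] := a01 k.+1 isT.
  rewrite big_nat_cond prodr_ile1// => k _.
  by have /andP[k0 k1] := a01 k.+1 isT; rewrite subr_ge0 k1 gerBl ltW.
have vd : v <= d'.
  apply: (@le_trans _ _ (\prod_(n2 <= k < n) (1 - a k.+1))).
    rewrite (le_trans vP)// ler_piMr// big_nat_cond prodr_ge0// => k _.
    by rewrite subr_ge0; have /andP[] := a01 k.+1 isT.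
  have : `|0 - \prod_(n2 <= k < n) (1 - a k.+1)| <= d' by near: n.
  by rewrite sub0r normrN => /(le_trans (ler_norm _)).
have /andP[vd1 vd2] : (v <= d) && (v <= e / 4 / (C + 1)).
  by move: vd; rewrite le_min.
rewrite sub0r normrN (le_trans Hv)//.
have /andP[G0 G1] := additive_recursion_bound n2 v (leq_maxl _ _) vI.
have A1 : `|H n2 v - 1| <= e / 4 by exact: Hd.
have A2 : `|expR (- G n2 v) - 1| <= e / 4.
  have E1 : 1 - G n2 v <= expR (- G n2 v) by exact: expR_ge1Dx.
  have E2 : expR (- G n2 v) <= 1 by rewrite -expR0 ler_expR oppr_le0.
  rewrite distrC ger0_norm ?subr_ge0// lerBlDr -lerBlDl (le_trans _ E1)//.
  rewrite lerD2l lerN2 (le_trans G1)//.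
  move: vd2; rewrite ler_pdivlMr// => /(le_trans _); apply.
  by rewrite mulrC ler_wpM2l// lerDl.
have A3 : e / 4 * u <= e / 4 by rewrite ler_piMr// ltW.
have -> : H n2 v - expR (- G n2 v) = (H n2 v - 1) - (expR (- G n2 v) - 1) by ring.
rewrite (le_trans (lerD (ler_normB _ _) A3))// (le_trans (lerD (lerD A1 A2) (lexx _)))//.
by lra.
Unshelve. all: by end_near. Qed.

End limit.

(** * Power series with nonnegative coefficients *)

Section generating_functions.
Variable R : realType.
Implicit Types (c : nat -> R) (F : R -> R).

Lemma nneseries_EFinP (u : nat -> R) (l : R) : (forall j, 0 <= u j) ->
  ((\sum_(j <oo) (u j)%:E)%E = l%:E) <->
  (\sum_(0 <= j < n) u j @[n --> \oo] --> l).
Proof.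
move=> u0.
have cv : cvgn (fun n => \sum_(0 <= j < n) (u j)%:E)%E.
  by apply: is_cvg_nneseries => j _ _; rewrite lee_fin.
have E : (fun n => \sum_(0 <= j < n) (u j)%:E)%E = EFin \o (fun n => \sum_(0 <= j < n) u j).
  by apply/funext => n /=; rewrite sumEFin.
split => [ul|ul].
  move: cv => /cvg_ex[l' cl']; have := cvg_lim (@ereal_hausdorff R) cl'.
  rewrite ul => ll'; rewrite -ll' E in cl'.
  exact: fine_cvg cl'.
by apply/cvg_lim => //; rewrite E; apply: cvg_comp ul _.
Qed.

(** Convergence is required up to s = 1, so the coefficients are summable with sum [F 1]; nothing is
    imposed on [F] outside [0,1]. *)
Definition gfun c F := (forall j, 0 <= c j) /\
  forall s, 0 <= s <= 1 -> \sum_(0 <= j < n) c j * s ^+ j @[n --> \oo] --> F s.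

(** At s = 0 the quotient would be 0 by convention instead of the value [c 1%N] of the shifted
    series. *)
Definition shift_gf c F s := if s == 0 then c 1%N else (F s - c 0%N) / s.

Lemma gfun_shift c F : gfun c F -> gfun (fun j => c j.+1) (shift_gf c F).
Proof.
move=> [c0 cF]; split=> // s sI; rewrite /shift_gf; case: eqP => [->|/eqP s0].
  apply: cvg_near_cst.
  near=> n; have -> : n = n.-1.+1 by rewrite prednK//; near: n; exists 1%N.
  rewrite big_nat_recl//= expr0 mulr1 big1 ?addr0// => i _.
  by rewrite exprS mul0r mulr0.
have -> : (fun n => \sum_(0 <= j < n) c j.+1 * s ^+ j) =
  (fun n => (\sum_(0 <= j < n.+1) c j * s ^+ j - c 0%N) / s).
  apply/funext => n; rewrite big_nat_recl// expr0 mulr1 addrAC subrr add0r.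
  by rewrite mulr_suml; apply: eq_bigr => i _; rewrite exprSr mulrA mulfK.
apply: cvgMl; apply: cvgB; last exact: cvg_cst.
by rewrite (cvg_shiftS (fun n => \sum_(0 <= j < n) c j * s ^+ j)); exact: cF.
Unshelve. all: by end_near. Qed.

Lemma gfun_partial_le c F s n : gfun c F -> 0 <= s <= 1 ->
  \sum_(0 <= j < n) c j * s ^+ j <= F s.
Proof.
move=> [c0 cF] sI; rewrite -(cvg_lim _ (cF _ sI))//.
have /andP[s0 _] := sI.
apply: nondecreasing_cvgn_le; last by apply/cvg_ex; exists (F s); exact: cF.
apply/nondecreasing_seqP => k; rewrite big_nat_recr//= lerDl.
by rewrite mulr_ge0// exprn_ge0.
Qed.

Lemma gfun_ge0 c F s : gfun c F -> 0 <= s <= 1 -> 0 <= F s.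
Proof. by move=> cF /(gfun_partial_le _ _ _ 0 cF); rewrite big_geq. Qed.

Lemma gfun_le1 c F s : gfun c F -> 0 <= s <= 1 -> F s <= F 1.
Proof.
move=> cF sI; have [c0 cv] := cF.
rewrite -(cvg_lim _ (cv _ sI))//; apply: limr_le.
  by apply/cvg_ex; exists (F s); exact: cv.
apply: nearW => n; rewrite (le_trans _ (gfun_partial_le c F 1 n cF _))//; last first.
  by rewrite ler01 lexx.
apply: ler_sum => i _; rewrite ler_wpM2l// expr1n; move/andP: sI => [s0 s1].
by rewrite exprn_ile1.
Qed.

Lemma gfun_recl c F s : gfun c F -> 0 <= s <= 1 -> F s = c 0%N + s * shift_gf c F s.
Proof.
move=> cF sI; rewrite /shift_gf; case: eqP => [s0|/eqP s0]; last first.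
  by rewrite mulrC divfK// addrC subrK.
rewrite s0 mul0r addr0; have [c0 cv] := cF.
rewrite s0 in sI; have := cv _ sI => /cvg_lim <-//.
apply/cvg_lim => //; apply: cvg_near_cst.
near=> n; have -> : n = n.-1.+1 by rewrite prednK//; near: n; exists 1%N.
rewrite big_nat_recl//= expr0 mulr1 big1 ?addr0// => i _.
by rewrite exprS mul0r mulr0.
Unshelve. all: by end_near. Qed.

Lemma shift_gf1 c F : gfun c F -> shift_gf c F 1 <= F 1.
Proof.
move=> [c0 cF]; rewrite /shift_gf oner_eq0 divr1 gerBl//.
Qed.

(** The remainder is [s ^+ n] times the n-fold shifted series, whose value at s is at most its value
    at 1, hence at most [F 1]. *)
Lemma gfun_partial_dist c F s n : gfun c F -> 0 <= s <= 1 ->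
  `|F s - \sum_(0 <= j < n) c j * s ^+ j| <= s ^+ n * F 1.
Proof.
move=> + sI; have /andP[s0 s1] := sI.
elim: n c F => [|n IH] c F cF.
  by rewrite big_geq// subr0 expr0 mul1r ger0_norm ?(gfun_ge0 c)// (gfun_le1 c).
rewrite (gfun_recl c F)// big_nat_recl// expr0 mulr1 opprD addrACA subrr add0r.
have -> : s * shift_gf c F s - \sum_(0 <= i < n) c i.+1 * s ^+ i.+1 =
   s * (shift_gf c F s - \sum_(0 <= i < n) c i.+1 * s ^+ i).
  rewrite mulrBr mulr_sumr; congr (_ - _); apply: eq_bigr => i _.
  by rewrite exprS; ring.
rewrite normrM ger0_norm// exprS -mulrA ler_wpM2l//.
rewrite (le_trans (IH _ _ (gfun_shift _ _ cF)))// ler_wpM2l ?exprn_ge0//.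
exact: shift_gf1.
Qed.

(* F s determines c 0 up to an error of order s, so that pointwise convergence
   of generating functions propagates to the coefficients one at a time. *)
Lemma gfun_head_cvg (I : Type) (FF : set_system I) {PF : ProperFilter FF}
    (c c' : I -> nat -> R) (f f' : I -> R -> R) (B : R) :
  (forall i, gfun (c i) (f i)) -> (forall i, gfun (c' i) (f' i)) ->
  (forall i, f i 1 <= B) -> (forall i, f' i 1 <= B) ->
  (forall s, 0 < s < 1 -> f i s - f' i s @[i --> FF] --> 0) ->
  c i 0%N - c' i 0%N @[i --> FF] --> 0.
Proof.
move=> cf cf' fB fB' ff'.
apply/cvgrPdist_le => e e0.
have [i0] := @filter_ex _ _ PF setT filterT => _.
have B0 : 0 <= B by rewrite (le_trans _ (fB i0))// (gfun_ge0 _ _ _ (cf i0))// ler01 lexx.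
(* Each constant coefficient differs from the value at s by at most [s * B], and this s makes the
   two errors together at most e/2. *)
pose s := Num.min (1/2) (e / 2 / (2 * B + 1)).
have B1 : 0 < 2 * B + 1 by rewrite ltr_wpDl// mulr_ge0.
have s0 : 0 < s by rewrite lt_min !divr_gt0.
have s12 : s <= 1 / 2 by rewrite ge_min lexx.
have s1 : s < 1 by lra.
have sB : s * (2 * B + 1) <= e / 2 by rewrite -ler_pdivlMr// ge_min lexx orbT.
have sI : 0 <= s <= 1 by rewrite !ltW.
have e20 : 0 < e / 2 by rewrite divr_gt0.
have s01 : 0 < s < 1 by rewrite s0.
move/cvgrPdist_le : (ff' _ s01) => /(_ _ e20) H.
near=> i; rewrite sub0r normrN.
have : `|0 - (f i s - f' i s)| <= e / 2 by near: i.
rewrite sub0r normrN.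
have := gfun_partial_dist _ _ _ 1 (cf i) sI; have := gfun_partial_dist _ _ _ 1 (cf' i) sI.
rewrite !big_nat1 !expr0 !mulr1 expr1 => A1 A2 A3.
have -> : c i 0%N - c' i 0%N = (f i s - f' i s) - (f i s - c i 0%N) + (f' i s - c' i 0%N).
  by ring.
rewrite (le_trans (ler_normD _ _))// (le_trans (lerD (ler_normB _ _) A1))//.
rewrite (le_trans (lerD (lerD A3 A2) (lexx _)))//.
have := fB i; have := fB' i => X Y.
have : s * f' i 1 <= s * B by rewrite ler_wpM2l// ltW.
have : s * f i 1 <= s * B by rewrite ler_wpM2l// ltW.
by lra.
Unshelve. all: by end_near. Qed.

(** Two families and an arbitrary proper filter serve two uses: the product filter on pairs of
    indices shows that coefficients are Cauchy, and a constant second family gives convergence to a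
    known limit. The induction shifts the series, whose values at 1 stay below [B]. *)
Lemma gfun_coef_cvg (I : Type) (FF : set_system I) {PF : ProperFilter FF}
    (c c' : I -> nat -> R) (f f' : I -> R -> R) (B : R) :
  (forall i, gfun (c i) (f i)) -> (forall i, gfun (c' i) (f' i)) ->
  (forall i, f i 1 <= B) -> (forall i, f' i 1 <= B) ->
  (forall s, 0 < s < 1 -> f i s - f' i s @[i --> FF] --> 0) ->
  forall j, c i j - c' i j @[i --> FF] --> 0.
Proof.
move=> cf cf' fB fB' ff' j.
elim: j c c' f f' cf cf' fB fB' ff' => [|j IH] c c' f f' cf cf' fB fB' ff'.
  exact: (gfun_head_cvg _ _ _ _ _ _ _ cf cf' fB fB').
apply: (IH (fun i j => c i j.+1) (fun i j => c' i j.+1)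
   (fun i => shift_gf (c i) (f i)) (fun i => shift_gf (c' i) (f' i))).
- by move=> i; exact: gfun_shift.
- by move=> i; exact: gfun_shift.
- by move=> i; rewrite (le_trans (shift_gf1 _ _ (cf i))).
- by move=> i; rewrite (le_trans (shift_gf1 _ _ (cf' i))).
move=> s s01; have /andP[s0 s1] := s01.
have -> : (fun i => shift_gf (c i) (f i) s - shift_gf (c' i) (f' i) s) =
  (fun i => ((f i s - f' i s) - (c i 0%N - c' i 0%N)) / s).
  apply/funext => i; rewrite /shift_gf gt_eqF// -mulrBl; congr (_ / _); ring.
have -> : 0 = (0 - 0) / s :> R by rewrite subr0 mul0r.
apply: cvgMl; apply: cvgB; first exact: ff'.
exact: (gfun_head_cvg _ _ _ _ _ _ _ cf cf' fB fB').
Qed.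

(** The coefficients are Cauchy by the preceding lemma, so no compactness argument occurs. The
    condition on [g] near 1 prevents a loss of mass at infinity. Convergence is assumed for s > 0
    only, so the limit series has its own value [r 0%N] at 0. *)
Lemma gfun_coef_lim (c : nat -> nat -> R) (f : nat -> R -> R) (g : R -> R) (B : R) :
  (forall n, gfun (c n) (f n)) -> (forall n, f n 1 <= B) ->
  (forall s, 0 < s <= 1 -> f n s @[n --> \oo] --> g s) ->
  (forall e, 0 < e -> exists2 s, 0 < s < 1 & g 1 - e <= g s) ->
  exists r : nat -> R, gfun r (fun s => if s == 0 then r 0%N else g s).
Proof.
move=> cf fB fg g1.
have cc j : cvgn (fun n => c n j).
  apply/cauchy_cvgP; apply: cauchy_exP => e e0.
  have PF : @ProperFilter (nat * nat)%type (filter_prod \oo \oo) by exact: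
    filter_prod_proper.
  have := @gfun_coef_cvg _ _ PF
    (fun nm : nat * nat => c nm.1) (fun nm : nat * nat => c nm.2)
    (fun nm => f nm.1) (fun nm => f nm.2) B.
  have e20 : 0 < e / 2 by rewrite divr_gt0.
  move=> /(_ (fun=> cf _) (fun=> cf _) (fun=> fB _) (fun=> fB _)) H.
  have {H} /cvgrPdist_le/(_ _ e20) : c nm.1 j - c nm.2 j @[nm --> (\oo, \oo)] --> 0.
    apply: H => s /andP[s0 s1]; rewrite -[X in _ --> X](subrr (g s)).
    have fgs : f n s @[n --> \oo] --> g s by apply: fg; rewrite s0 ltW.
    apply: cvgB; first exact: (cvg_comp _ _ cvg_fst fgs).
    exact: (cvg_comp _ _ cvg_snd fgs).
  case=> -[P Q] /= [[N _ NP] [M _ MQ]] PQ.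
  exists (c N j); exists M => // n /= Mn; rewrite -ball_normE/=.
  have := PQ (N, n) (conj (NP _ (leqnn N)) (MQ _ Mn)).
  rewrite /= sub0r normrN => /le_lt_trans; apply.
  by rewrite ltr_pdivrMr// ltr_pMr// ltr1n.
pose r j := limn (fun n => c n j).
have cr j : c n j @[n --> \oo] --> r j := cc j.
have r0 j : 0 <= r j by apply: limr_ge => //; apply: nearW => n; have [] := cf n.
have fg0 s J : 0 < s <= 1 ->
    \sum_(0 <= j < J) c n j * s ^+ j @[n --> \oo] --> \sum_(0 <= j < J) r j * s ^+ j.
  move=> s01; elim: J => [|J IH].
    by under eq_fun do rewrite big_geq//; rewrite big_geq//; exact: cvg_cst.
  under eq_fun do rewrite big_nat_recr//=; rewrite big_nat_recr//=.
  by apply: cvgD => //; apply: cvgMl; exact: cr.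
have B0 : 0 <= B.
  by rewrite (le_trans _ (fB 0%N))// (gfun_ge0 _ _ _ (cf 0%N))// ler01 lexx.
have rg s : 0 < s < 1 -> \sum_(0 <= j < J) r j * s ^+ j @[J --> \oo] --> g s.
  move=> /andP[s0 s1]; have sI : 0 <= s <= 1 by rewrite !ltW.
  have s01 : 0 < s <= 1 by rewrite s0 ltW.
  (* The truncation error [s ^+ J * B] is uniform in n, hence survives the limit in n taken before
     the one in J. *)
  have D J : `|g s - \sum_(0 <= j < J) r j * s ^+ j| <= s ^+ J * B.
    have C1 : f n s - \sum_(0 <= j < J) c n j * s ^+ j @[n --> \oo] -->
      g s - \sum_(0 <= j < J) r j * s ^+ j by apply: cvgB; [exact: fg|exact: fg0].
    have C2 : `|f n s - \sum_(0 <= j < J) c n j * s ^+ j| @[n --> \oo] -->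
      `|g s - \sum_(0 <= j < J) r j * s ^+ j| by exact: cvg_norm.
    rewrite -(cvg_lim _ C2)//; apply: limr_le; first by apply/cvg_ex; eexists; exact: C2.
    apply: nearW => n; rewrite (le_trans (gfun_partial_dist _ _ _ _ (cf n) sI))//.
    by rewrite ler_wpM2l ?exprn_ge0// ltW.
  have E : s ^+ J * B @[J --> \oo] --> 0.
    rewrite -(mul0r B); apply: cvgMl; apply: cvg_expr.
    by rewrite ger0_norm// ltW.
  apply/cvgrPdist_le => e e0; move/cvgrPdist_le : E => /(_ _ e0); apply: filterS => J.
  rewrite sub0r normrN => /(le_trans (ler_norm _)).
  exact: le_trans.
exists r; split=> // s /andP[s0 s1]; case: eqP => [->|/eqP sn0].
  apply: cvg_near_cst.
  near=> n; have -> : n = n.-1.+1 by rewrite prednK//; near: n; exists 1%N.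
  rewrite big_nat_recl//= expr0 mulr1 big1 ?addr0// => i _.
  by rewrite exprS mul0r mulr0.
have {sn0} s0' : 0 < s by rewrite lt_neqAle eq_sym sn0.
move: s1; rewrite le_eqVlt => /orP[/eqP->|s1]; last by apply: rg; rewrite s0'.
have one01 : 0 < (1 : R) <= 1 by rewrite ltr01 lexx.
have ub J : \sum_(0 <= j < J) r j * 1 ^+ j <= g 1.
  have C1 := fg0 1 J one01; have C2 := fg 1 one01.
  rewrite -(cvg_lim _ C1)// -(cvg_lim _ C2)//; apply: ler_lim.
  - by apply/cvg_ex; eexists; exact: C1.
  - by apply/cvg_ex; eexists; exact: C2.
  by apply: nearW => n; rewrite (gfun_partial_le _ _ _ _ (cf n))// ler01 lexx.
apply/cvgrPdist_le => e e0.
have e20 : 0 < e / 2 by rewrite divr_gt0.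
(* Lower bound at s = 1: the partial sums at t nearly reach [g t], which is nearly [g 1], and they
   increase with the argument. *)
have [t t01 gt] := g1 _ e20.
move/cvgrPdist_le : (rg _ t01) => /(_ _ e20); apply: filterS => J.
move=> /(le_trans (ler_norm _)) gJ; rewrite ger0_norm ?subr_ge0//.
have : \sum_(0 <= j < J) r j * t ^+ j <= \sum_(0 <= j < J) r j * 1 ^+ j.
  apply: ler_sum => j _; rewrite ler_wpM2l// expr1n; move/andP: t01 => [/ltW t0 /ltW t1].
  by rewrite exprn_ile1.
move: gJ; set x := \sum_(0 <= j < J) _; set y := \sum_(0 <= j < J) _; lra.
Unshelve. all: by end_near. Qed.

Lemma gfunD c F c' F' : gfun c F -> gfun c' F' ->
  gfun (fun j => c j + c' j) (fun s => F s + F' s).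
Proof.
move=> [c0 cF] [c'0 cF']; split=> [j|s sI]; first by rewrite addr_ge0.
under eq_fun do (under eq_bigr do rewrite mulrDl; rewrite big_split/=).
by apply: cvgD; [exact: cF|exact: cF'].
Qed.

Lemma gfun_head c F b : gfun c F -> 0 <= b ->
  gfun (fun j => if j is 0%N then b else c j) (fun s => F s - c 0%N + b).
Proof.
move=> [c0 cF] b0; split=> [[|j]//|s sI].
rewrite -(cvg_shiftS (fun n => \sum_(0 <= j < n) _ * s ^+ j)).
have -> : (fun n => \sum_(0 <= j < n.+1) (if j is 0%N then b else c j) * s ^+ j) =
    (fun n => \sum_(0 <= j < n.+1) c j * s ^+ j - c 0%N + b).
  apply/funext => n; rewrite !big_nat_recl// !expr0 !mulr1.
  by rewrite [X in X + b]addrAC subrr add0r addrC.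
apply: cvgD; last exact: cvg_cst.
apply: cvgB; last exact: cvg_cst.
by rewrite (cvg_shiftS (fun n => \sum_(0 <= j < n) c j * s ^+ j)); exact: cF.
Qed.

(** Expanding every power of [f] gives a double series of nonnegative terms. It is summed in the
    other order in the extended reals, where no convergence has to be known beforehand. *)
Lemma gfun_comp (w : nat -> R) (F f : R -> R) (kappa : nat -> nat -> R) :
  gfun w F -> (forall j, gfun (kappa j) (fun s => f s ^+ j)) ->
  (forall s, 0 <= s <= 1 -> 0 <= f s <= 1) ->
  exists c, gfun c (fun s => F (f s)).
Proof.
move=> [w0 wF] kf f01.
have one01 : 0 <= (1 : R) <= 1 by rewrite ler01 lexx.
have k0 j i : 0 <= kappa j i by have [] := kf j.
have kE j s : 0 <= s <= 1 -> (\sum_(i <oo) (kappa j i * s ^+ i)%:E)%E = (f s ^+ j)%:E.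
  move=> sI; have [_ kf'] := kf j; apply/nneseries_EFinP; last exact: kf'.
  by move=> i; rewrite mulr_ge0// exprn_ge0//; case/andP: sI.
have wE s : 0 <= s <= 1 -> (\sum_(j <oo) (w j * s ^+ j)%:E)%E = (F s)%:E.
  move=> sI; apply/nneseries_EFinP; last exact: wF.
  by move=> i; rewrite mulr_ge0// exprn_ge0//; case/andP: sI.
pose C i := (\sum_(j <oo) (w j * kappa j i)%:E)%E.
have C0 i : (0 <= C i)%E by apply: nneseries_ge0 => j _ _; rewrite lee_fin mulr_ge0.
have E s : 0 <= s <= 1 -> (\sum_(i <oo) ((s ^+ i)%:E * C i) = (F (f s))%:E)%E.
  move=> sI; have /andP[s0 s1] := sI.
  rewrite -(wE _ (f01 _ sI)).
  have -> : (\sum_(i <oo) ((s ^+ i)%:E * C i) =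
     \sum_(i <oo) \sum_(j <oo) (w j * (kappa j i * s ^+ i))%:E)%E.
    apply: eq_eseriesr => i _; rewrite -nneseriesZl; last first.
      by move=> j _; rewrite lee_fin mulr_ge0.
    by apply: eq_eseriesr => j _; rewrite -EFinM; congr EFin; ring.
  rewrite nneseries_interchange; last first.
    by move=> i j; rewrite lee_fin !mulr_ge0// exprn_ge0.
  apply: eq_eseriesr => j _; rewrite [RHS]EFinM -kE// -nneseriesZl; last first.
    by move=> i _; rewrite lee_fin mulr_ge0// exprn_ge0.
  by [].
(* At s = 1 the coefficient [C i] is one of the nonnegative terms of a series with finite sum
   [F (f 1)]. *)
have Cfin i : C i \is a fin_num.
  rewrite ge0_fin_numE//; apply: (@le_lt_trans _ _ (F (f 1))%:E); last by rewrite ltry.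
  rewrite -E// (@nneseriesD1 _ _ i)//; last by move=> j _; rewrite mule_ge0// lee_fin
    exprn_ge0.
  rewrite expr1n mul1e leeDl//; apply: nneseries_ge0 => j _ _.
  by rewrite mule_ge0// lee_fin exprn_ge0.
exists (fun i => fine (C i)); split=> [i|s sI]; first by rewrite fine_ge0.
apply/nneseries_EFinP.
  by move=> i; rewrite mulr_ge0 ?fine_ge0// exprn_ge0//; case/andP: sI.
rewrite -E//; apply: eq_eseriesr => i _.
by rewrite EFinM fineK// muleC.
Qed.

(** The first [J] coefficients carry the mass [F 1] up to e/2 and, by Bernoulli's inequality, lose
    at most [J%:R * u * F 1] when the argument moves from 1 to [1 - u]. This covers variables of
    infinite mean. *)
Lemma gfun_left_continuous c F e : gfun c F -> 0 < e -> exists2 d, 0 < d &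
  forall u, 0 <= u <= 1 -> u <= d -> F 1 - e <= F (1 - u).
Proof.
move=> cF e0; have [c0 cv] := cF.
have one01 : 0 <= (1 : R) <= 1 by rewrite ler01 lexx.
have e20 : 0 < e / 2 by rewrite divr_gt0.
move/cvgrPdist_le : (cv 1 one01) => /(_ _ e20)[J _ /(_ _ (leqnn J))].
move=> /(le_trans (ler_norm _)) HJ.
have F1 : 0 <= F 1 by exact: (gfun_ge0 _ _ _ cF).
have D0 : 0 < J%:R * F 1 + 1 by rewrite ltr_wpDl// mulr_ge0.
exists (e / 2 / (J%:R * F 1 + 1)); first by rewrite divr_gt0.
move=> u /andP[u0 u1]; rewrite ler_pdivlMr// => ud.
have sI : 0 <= 1 - u <= 1 by rewrite subr_ge0 u1 gerBl.
apply: le_trans (gfun_partial_le _ _ _ J cF sI).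
have bern j : 1 - j%:R * u <= (1 - u) ^+ j.
  elim: j => [|j IH]; first by rewrite mul0r subr0 expr0.
  rewrite exprS (le_trans _ (ler_wpM2l _ IH)) ?subr_ge0// -natr1.
  have : 0 <= j%:R * u ^+ 2 by rewrite mulr_ge0// exprn_ge0.
  rewrite mulrDl mul1r; set x := j%:R * u; rewrite expr2 mulrA -/x.
  by nra.
have S : \sum_(0 <= j < J) c j * (1 - J%:R * u) <= \sum_(0 <= j < J) c j * (1 - u) ^+ j.
  rewrite big_nat_cond [leRHS]big_nat_cond; apply: ler_sum => j /andP[/andP[_ jJ] _].
  rewrite ler_wpM2l// (le_trans _ (bern j))// lerD2l lerN2 ler_wpM2r// ler_nat.
  exact: ltnW.
apply: le_trans S; rewrite -mulr_suml.
have P1 := gfun_partial_le _ _ _ J cF one01.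
have E : \sum_(0 <= j < J) c j * 1 ^+ j = \sum_(0 <= j < J) c j.
  by apply: eq_bigr => j _; rewrite expr1n mulr1.
rewrite E in HJ P1; move: HJ P1; set x := \sum_(0 <= j < J) c j => HJ P1.
have : J%:R * u * x <= J%:R * u * F 1 by rewrite ler_wpM2l// mulr_ge0.
move: ud; rewrite mulrDr mulr1 mulrBr mulr1 mulrCA mulrA [x * _]mulrC.
by move: (J%:R * u * F 1) (J%:R * u * x) => y z; lra.
Qed.

End generating_functions.

(** * Integer-valued random variables *)

Section nat_random_variables.
Context {R : realType} {d : measure_display} {T : measurableType d}.
Variable P : probability T R.
Implicit Types X : {RV P >-> nat}.

Lemma measurable_nat_preimage X (A : set nat) : measurable (X @^-1` A).
Proof. by rewrite -[X in measurable X]setTI; apply: measurable_funP. Qed.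
#[local] Hint Resolve measurable_nat_preimage : core.

Lemma measurable_nat_comp (d' : measure_display) (T' : measurableType d')
  (phi : nat -> T') X : measurable_fun setT (fun w => phi (X w)).
Proof.
by move=> _ B mB; rewrite setTI; apply: (measurable_nat_preimage X (phi @^-1` B)).
Qed.

(** [X] is a bare function with measurable fibres, so that the population size [gwvei] is directly
    admissible. *)
Lemma ge0_integral_nat_split (X : T -> nat) (D : set T) (F : T -> \bar R) :
  (forall k, measurable (X @^-1` [set k])) -> measurable D ->
  measurable_fun setT F -> (forall x, (0 <= F x)%E) ->
  (\int[P]_(x in D) F x = \sum_(k <oo) \int[P]_(x in D `&` X @^-1` [set k]) F x)%E.
Proof.
move=> mX mD mF F0.
have DE : D = \bigcup_k (D `&` X @^-1` [set k]).
  rewrite -setI_bigcupr; apply/seteqP; split=> x /=; last by case.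
  by move=> Dx; split=> //; exists (X x).
rewrite {1}DE ge0_integral_bigcup//.
- by move=> k; apply: measurableI.
- by rewrite -DE; exact: measurable_funTS.
- apply/trivIsetP => i j _ _ ij; rewrite setIACA setIid.
  rewrite (_ : _ `&` (X @^-1` [set j]) = set0) ?setI0//.
  by apply/seteqP; split=> x //= [-> /eqP]; rewrite (negbTE ij).
Qed.

Lemma measure_nat_split (X : T -> nat) (D : set T) :
  (forall k, measurable (X @^-1` [set k])) -> measurable D ->
  (P D = \sum_(k <oo) P (D `&` X @^-1` [set k]))%E.
Proof.
move=> mX mD.
have := ge0_integral_nat_split X D (cst 1%E) mX mD.
rewrite integral_cst// mul1e => ->//.
by apply: eq_eseriesr => k _; rewrite integral_cst ?mul1e//; exact: measurableI.
Qed.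

Definition nat_pmf (X : T -> nat) (j : nat) : R := fine (P (X @^-1` [set j])).
Definition nat_pgf (X : T -> nat) (s : R) : R := fine 'E_P[fun w => s ^+ X w].

Lemma nat_pmfE X j : (P (X @^-1` [set j]) = (nat_pmf X j)%:E)%E.
Proof. by rewrite /nat_pmf fineK// fin_num_measure. Qed.

Lemma nat_pmf_ge0 X j : 0 <= nat_pmf X j.
Proof. by rewrite -lee_fin -nat_pmfE. Qed.

Lemma ge0_expectation_nat X (psi : nat -> R) : (forall k, 0 <= psi k) ->
  ('E_P[fun w => psi (X w)] = \sum_(k <oo) (psi k * nat_pmf X k)%:E)%E.
Proof.
move=> psi0; rewrite unlock (ge0_integral_nat_split X)//; last 2 first.
- by apply/measurable_EFinP; exact: (measurable_nat_comp _ _ psi).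
- by move=> x; rewrite lee_fin.
apply: eq_eseriesr => k _.
rewrite setTI EFinM -nat_pmfE -integral_cst//.
by apply: eq_integral => w; rewrite inE /= => ->.
Qed.

Lemma expectation_ident X X' (psi : nat -> R) :
  distribution P X = distribution P X' -> (forall k, 0 <= psi k) ->
  ('E_P[fun w => psi (X w)] = 'E_P[fun w => psi (X' w)])%E.
Proof.
move=> XX' psi0.
have E k : nat_pmf X k = nat_pmf X' k.
  rewrite /nat_pmf; congr fine.
  by have := congr1 (fun m : set nat -> \bar R => m [set k]) XX'.
by rewrite !ge0_expectation_nat//; apply: eq_eseriesr => k _; rewrite E.
Qed.

Lemma nat_pgfE X s : 0 <= s <= 1 -> pgf X s = (nat_pgf X s)%:E.
Proof.
move=> /andP[s0 s1]; rewrite /pgf /nat_pgf fineK// ge0_fin_numE; last first.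
  by apply: expectation_ge0 => w; rewrite exprn_ge0.
apply: (@le_lt_trans _ _ 'E_P[cst 1%R]%E); last by rewrite expectation_cst ltry.
apply: expectation_le.
- exact: (measurable_nat_comp _ _ (fun k => s ^+ k)).
- exact: measurable_cst.
- by move=> w; rewrite exprn_ge0.
- by move=> w /=.
by apply: aeW => w; rewrite /= exprn_ile1.
Qed.

Lemma nat_pgf_gfun X : gfun R (nat_pmf X) (nat_pgf X).
Proof.
split=> [j|s sI]; first exact: nat_pmf_ge0.
have /andP[s0 _] := sI.
apply/nneseries_EFinP; first by move=> j; rewrite mulr_ge0 ?nat_pmf_ge0 ?exprn_ge0.
rewrite -nat_pgfE// /pgf (ge0_expectation_nat X (fun k => s ^+ k)); last first.
  by move=> k; rewrite exprn_ge0.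
by apply: eq_eseriesr => k _; rewrite mulrC.
Qed.

Lemma nat_pgf1 X : nat_pgf X 1 = 1.
Proof.
rewrite /nat_pgf; under [X in 'E_P[X]%E]eq_fun do rewrite expr1n.
by rewrite (expectation_cst P 1).
Qed.

Lemma nat_pgf_itv X s : 0 <= s <= 1 -> 0 <= nat_pgf X s <= 1.
Proof.
move=> sI; rewrite (gfun_ge0 _ _ _ _ (nat_pgf_gfun X))//=.
by rewrite -(nat_pgf1 X) (gfun_le1 _ _ _ _ (nat_pgf_gfun X)).
Qed.

End nat_random_variables.

(** * Bonferroni inequalities and factorial moments *)

Section bonferroni.
Variable R : realType.

(** Pascal's rule gives r(x+1, K+1) = r(x, K+1) - u r(x, K) for the remainders, and the claimed
    bounds add up by the same rule. *)
Lemma bonferroni (u : R) (K x : nat) : 0 <= u <= 1 ->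
  `|(1 - u) ^+ x - \sum_(0 <= k < K) (-1) ^+ k * 'C(x, k)%:R * u ^+ k|
    <= 'C(x, K)%:R * u ^+ K.
Proof.
move=> /andP[u0 u1].
elim: x K => [|x IH] [|K].
- by rewrite big_geq// subr0 !expr0 normr1 bin0 mul1r.
- rewrite big_nat_recl//= big_nat_cond big1; last first.
    by move=> i _; rewrite bin0n mulr0 mul0r.
  by rewrite !expr0 bin0 !mulr1 addr0 subrr normr0 mulr_ge0// exprn_ge0.
- rewrite big_geq// subr0 expr0 bin0 mulr1 ger0_norm ?exprn_ge0 ?subr_ge0//.
  by rewrite exprn_ile1 ?subr_ge0// gerBl.
have -> : (1 - u) ^+ x.+1 - \sum_(0 <= k < K.+1) (-1) ^+ k * 'C(x.+1, k)%:R * u ^+ k =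
   ((1 - u) ^+ x - \sum_(0 <= k < K.+1) (-1) ^+ k * 'C(x, k)%:R * u ^+ k)
   - u * ((1 - u) ^+ x - \sum_(0 <= k < K) (-1) ^+ k * 'C(x, k)%:R * u ^+ k).
  rewrite !big_nat_recl// !bin0 mulrBr mulr_sumr exprS.
  have -> : \sum_(0 <= i < K) (-1) ^+ i.+1 * 'C(x.+1, i.+1)%:R * u ^+ i.+1 =
    \sum_(0 <= i < K) (-1) ^+ i.+1 * 'C(x, i.+1)%:R * u ^+ i.+1 -
    \sum_(0 <= i < K) u * ((-1) ^+ i * 'C(x, i)%:R * u ^+ i).
    rewrite -sumrB; apply: eq_bigr => i _.
    by rewrite binS natrD !exprS; ring.
  by ring.
rewrite (le_trans (ler_normB _ _))// binS natrD mulrDl lerD ?IH//.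
by rewrite normrM (ger0_norm u0) exprS mulrCA ler_wpM2l// IH.
Qed.

End bonferroni.

Section moments.
Context {R : realType} {d : measure_display} {T : measurableType d}.
Variable P : probability T R.
Implicit Types X : {RV P >-> nat}.

(** Expectation of the Bonferroni inequality, a binomial coefficient being a falling factorial over
    k!. Finite moments provide the integrability of each term. *)
Lemma pgf_expansion X (K : nat) (u : R) :
  (forall k, (0 < k <= K)%N -> fact_moment k X \is a fin_num) -> 0 <= u <= 1 ->
  `|nat_pgf P X (1 - u) -
    \sum_(0 <= k < K) (-1) ^+ k * (fine (fact_moment k X) / k`!%:R) * u ^+ k|
    <= fine (fact_moment K X) / K`!%:R * u ^+ K.
Proof.
move=> finX uI; have /andP[u0 u1] := uI.
have ib k : (k <= K)%N -> P.-integrable setT (EFin \o (fun w => 'C(X w, k)%:R)) /\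
    (\int[P]_w ('C(X w, k)%:R : R))%R = fine (fact_moment k X) / k`!%:R.
  move=> kK.
  have kf0 : (k`!%:R : R) != 0 by rewrite pnatr_eq0 -lt0n fact_gt0.
  have i1 : P.-integrable setT (EFin \o (fun w => (X w ^_ k)%:R)).
    apply/integrableP; split.
      by apply/measurable_EFinP; exact: (measurable_nat_comp _ _ _ (fun n => (n ^_ k)%:R
        : R)).
    have -> : (\int[P]_x `|(EFin \o (fun w => (X w ^_ k)%:R)) x|)%E = fact_moment k X.
      rewrite /fact_moment unlock; apply: eq_integral => w _ /=.
      by rewrite ger0_norm.
    (* The finiteness hypothesis starts at order 1; the moment of order 0 equals 1. *)
    have [k0|k0] := posnP k; last by rewrite ltey_eq finX// k0.
    rewrite k0 /fact_moment; under [X in 'E_P[X]%E]eq_fun do rewrite ffactn0.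
    by rewrite (expectation_cst P 1) ltry.
  have E : (fun w => 'C(X w, k)%:R) = (fun w => k`!%:R^-1 * (X w ^_ k)%:R) :> (T -> R).
    by apply/funext => w; rewrite -bin_ffact natrM mulrC mulfK.
  rewrite E; split; first exact: (integrableZl measurableT _ i1).
  by rewrite RintegralZl// mulrC /fact_moment /Rintegral unlock.
pose e K' w := (1 - u) ^+ X w - \sum_(0 <= k < K') (-1) ^+ k * 'C(X w, k)%:R * u ^+ k.
have he K' : (K' <= K)%N -> P.-integrable setT (EFin \o e K') /\
   (\int[P]_w e K' w)%R = nat_pgf P X (1 - u) -
    \sum_(0 <= k < K') (-1) ^+ k * (fine (fact_moment k X) / k`!%:R) * u ^+ k.
  elim: K' => [_|K' IH K'K].
    have E : e 0%N = (fun w => (1 - u) ^+ X w).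
      by apply/funext => w; rewrite /e big_geq// subr0.
    rewrite E big_geq// subr0; split; last by rewrite /nat_pgf /Rintegral unlock.
    apply: (@le_integrable _ _ _ P setT measurableT _ (EFin \o cst 1)).
    - by apply/measurable_EFinP; exact: (measurable_nat_comp _ _ _ (fun n => (1 - u) ^+ n
      : R)).
    - move=> w _ /=; rewrite lee_fin normr1 ger0_norm ?exprn_ge0 ?subr_ge0//.
      by rewrite exprn_ile1 ?subr_ge0// gerBl.
    exact: finite_measure_integrable_cst.
  have [i1 i2] := IH (ltnW K'K); have [j1 j2] := ib K' (ltnW K'K).
  have E : e K'.+1 = (fun w => e K' w - ((-1) ^+ K' * u ^+ K') * 'C(X w, K')%:R).
    by apply/funext => w; rewrite /e big_nat_recr//=; ring.
  have j3 : P.-integrable setT (EFin \o (fun w => ((-1) ^+ K' * u ^+ K') * 'C(X w, K')%:R)).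
    exact: (integrableZl measurableT _ j1).
  rewrite E; split; first exact: (integrableB measurableT i1 j3).
  rewrite RintegralB// i2 RintegralZl// j2 big_nat_recr//=.
  by ring.
have [i1 <-] := he K (leqnn K); have [j1 <-] := ib K (leqnn K).
rewrite -RintegralZr// (le_trans (le_normr_Rintegral _ _))//.
apply: le_Rintegral => //.
- exact: (integrable_norm i1).
- exact: (integrableZr measurableT _ j1).
by move=> w _; exact: bonferroni.
Qed.

End moments.

(** * Independence *)

Section independence.
Context {R : realType} {d : measure_display} {T : measurableType d}.
Variable P : probability T R.
Variables (I : choiceType) (X : I -> {RV P >-> nat}).
Implicit Types (C : set T) (J : seq I) (A : I -> set nat).

Definition joint_event J A : set T := \bigcap_(i in [set` J]) X i @^-1` A i.

(** Under [P] restricted to [C], the variables of [J] are independent with their unconditional laws.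
    [C] stands for the past; with [C = setT] this is independence of the family itself. *)
Definition indep_of C J := forall A,
  (P (C `&` joint_event J A) = P C * \prod_(i <- J) P (X i @^-1` A i))%E.

Lemma joint_event_nil A : joint_event [::] A = setT.
Proof. by apply/seteqP; split=> x //= _ i. Qed.

Lemma joint_event_cons i J A :
  joint_event (i :: J) A = X i @^-1` A i `&` joint_event J A.
Proof.
apply/seteqP; split=> x /=.
  move=> H; split; first by apply: H; rewrite /= inE eqxx.
  by move=> j jJ; apply: H; rewrite /= inE jJ orbT.
by move=> [Hi HJ] j /=; rewrite inE => /orP[/eqP->//|]; exact: HJ.
Qed.

Lemma joint_event_cat J J' A :
  joint_event (J ++ J') A = joint_event J A `&` joint_event J' A.
Proof.
elim: J => [|i J IH]; first by rewrite joint_event_nil setTI.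
by rewrite cat_cons !joint_event_cons IH setIA.
Qed.

Lemma measurable_joint_event J A : measurable (joint_event J A).
Proof.
elim: J => [|i J IH]; first by rewrite joint_event_nil.
by rewrite joint_event_cons; apply: measurableI => //; exact: measurable_nat_preimage.
Qed.

Lemma eq_joint_event J A B : {in J, A =1 B} -> joint_event J A = joint_event J B.
Proof.
by move=> AB; apply/seteqP; split=> x H i /= iJ; have := H i iJ; rewrite /= AB.
Qed.

Lemma mutually_independent_seq (D : set I) J A :
  mutually_independent D X -> uniq J -> (forall i, i \in J -> D i) ->
  (P (joint_event J A) = \prod_(i <- J) P (X i @^-1` A i))%E.
Proof.
move=> ind uJ JD.
have := ind [fset i in J]%fset A.
have -> : [set` [fset i in J]%fset] = [set` J].
  by apply/seteqP; split=> i /=; rewrite !inE.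
move=> ->//.
apply: perm_big; apply: uniq_perm => // i.
by rewrite !inE.
Qed.

(** A singleton at the head index moves the event [X i = k] from the family into [C], and [setT] at
    the other indices makes them disappear. This drives the inductions on [J] below. *)
Lemma indep_of_consP C i J : i \notin J -> indep_of C (i :: J) ->
  (forall k, P (C `&` X i @^-1` [set k]) = P C * P (X i @^-1` [set k]))%E /\
  forall k, indep_of (C `&` X i @^-1` [set k]) J.
Proof.
move=> iJ CJ.
have E A k : joint_event (i :: J) (fun j => if j == i then [set k] else A j) =
    X i @^-1` [set k] `&` joint_event J A.
  rewrite joint_event_cons eqxx; congr (_ `&` _).
  by apply: eq_joint_event => j jJ; case: eqP => // ji; rewrite -ji jJ in iJ.
have F A k : (\prod_(j <- J) P (X j @^-1` (if j == i then [set k] else A j)) =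
    \prod_(j <- J) P (X j @^-1` A j))%E.
  by apply: eq_big_seq => j jJ; case: eqP => // ji; rewrite -ji jJ in iJ.
have H k : (P (C `&` X i @^-1` [set k]) = P C * P (X i @^-1` [set k]))%E.
  have := CJ (fun j => if j == i then [set k] else setT).
  rewrite E big_cons eqxx F big1 ?mule1; last by move=> j _; rewrite preimage_setT
    probability_setT.
  have -> : joint_event J (fun=> setT) = setT by apply/seteqP; split.
  by rewrite setIT.
split=> // k A; rewrite H -setIA -E CJ big_cons eqxx F muleA//.
Qed.

(** Sum over the values of the head variable: on each piece its factor is constant and its value is
    absorbed into the event, to which the induction hypothesis applies. *)
Lemma ge0_integral_indep C J (psi : I -> nat -> R) (e : I -> R) :
  measurable C -> uniq J -> indep_of C J -> (forall i k, 0 <= psi i k) ->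
  (forall i, i \in J -> 'E_P[fun w => psi i (X i w)]%E = (e i)%:E) ->
  (\int[P]_(w in C) (\prod_(i <- J) psi i (X i w))%:E =
    P C * (\prod_(i <- J) e i)%:E)%E.
Proof.
move=> + + + psi0.
elim: J C => [|i J IH] C mC uJ CJ eJ.
  by under eq_integral do rewrite big_nil; rewrite big_nil integral_cst// mule1 mul1e.
move: uJ => /= /andP[iJ uJ].
have [Ci CiJ] := indep_of_consP _ _ _ iJ CJ.
have mX k : measurable (X i @^-1` [set k]) by exact: measurable_nat_preimage.
have mprod J' : measurable_fun setT (fun w => (\prod_(i <- J') psi i (X i w))%:E).
  apply/measurable_EFinP; apply: measurable_prod => j _.
  exact: (measurable_nat_comp _ _ _ (psi j)).
rewrite (ge0_integral_nat_split _ (X i))//; last first.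
  by move=> w; rewrite lee_fin prodr_ge0.
have step k : (\int[P]_(x in C `&` X i @^-1` [set k]) (\prod_(j <- i :: J) psi j (X j
  x))%:E =
   (fine (P C) * \prod_(j <- J) e j)%:E * (psi i k * nat_pmf P (X i) k)%:E)%E.
  have mCk : measurable (C `&` X i @^-1` [set k]) by exact: measurableI.
  transitivity (\int[P]_(x in C `&` X i @^-1` [set k]) ((psi i k)%:E * (\prod_(j <- J)
    psi j (X j x))%:E))%E.
    apply: eq_integral => w; rewrite inE => -[_ /= Xk].
    by rewrite big_cons Xk EFinM.
  rewrite ge0_integralZl//; last 3 first.
  - exact: measurable_funTS.
  - by move=> w _; rewrite lee_fin prodr_ge0.
  - by rewrite lee_fin.
  rewrite IH//; last by move=> j jJ; apply: eJ; rewrite inE jJ orbT.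
  rewrite Ci nat_pmfE -{1}[P C]fineK ?fin_num_measure// -!EFinM; congr EFin; ring.
rewrite (eq_eseriesr (fun k _ => step k)) nneseriesZl; last first.
  by move=> k _; rewrite lee_fin mulr_ge0// nat_pmf_ge0.
rewrite -ge0_expectation_nat// eJ ?inE ?eqxx// big_cons.
rewrite -{2}[P C]fineK ?fin_num_measure// -!EFinM; congr EFin; ring.
Qed.

Lemma measurable_seq_event J (A : set (seq nat)) :
  measurable [set w | A [seq X i w | i <- J]].
Proof.
elim: J A => [|i J IH] A.
  have [A0|A0] := pselect (A [::]).
    by rewrite (_ : [set _ | _] = setT)//; apply/seteqP; split.
  by rewrite (_ : [set _ | _] = set0)//; apply/seteqP; split.
rewrite (_ : [set _ | _] =
   \bigcup_k (X i @^-1` [set k] `&` [set w | A (k :: [seq X i w | i <- J])])).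
  apply: bigcup_measurable => k _; apply: measurableI; first exact: measurable_nat_preimage.
  exact: (IH [set s | A (k :: s)]).
apply/seteqP; split=> w /=; first by exists (X i w).
by move=> [k _ [/= -> ]].
Qed.

Lemma indep_of_tail C i J : i \notin J -> indep_of C (i :: J) -> indep_of C J.
Proof.
move=> iJ CJ A; have := CJ (fun j => if j == i then setT else A j).
rewrite joint_event_cons eqxx preimage_setT setTI big_cons eqxx.
rewrite preimage_setT probability_setT mul1e (eq_joint_event _ _ A); last first.
  by move=> j jJ; case: eqP => // ji; rewrite -ji jJ in iJ.
move=> ->; congr (_ * _)%E; apply: eq_big_seq => j jJ.
by case: eqP => // ji; rewrite -ji jJ in iJ.
Qed.

(** Needed because a condition on a sum of variables is not a product event. Splitting along the
    value of the head reduces to shorter lists. *)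
Lemma indep_of_seq_event C J (A : set (seq nat)) :
  measurable C -> uniq J -> indep_of C J -> indep_of setT J ->
  (P (C `&` [set w | A [seq X i w | i <- J]]) =
    P C * P [set w | A [seq X i w | i <- J]])%E.
Proof.
elim: J A C => [|i J IH] A C mC.
  move=> _ _ _; have [A0|A0] := pselect (A [::]).
    rewrite (_ : [set _ | _] = setT) ?setIT ?probability_setT ?mule1//.
    by apply/seteqP; split.
  rewrite (_ : [set _ | _] = set0) ?setI0 ?measure0 ?mule0//.
  by apply/seteqP; split.
move=> /= /andP[iJ uJ] CJ TJ.
have mX k : measurable (X i @^-1` [set k]) by exact: measurable_nat_preimage.
pose E k := [set w | A (k :: [seq X i w | i <- J])].
have mE k : measurable (E k) by exact: (measurable_seq_event J [set s | A (k :: s)]).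
(* [q] does not involve the event [C'] of the next claim; the case [C' = setT] identifies it with
   the probability sought. *)
pose q := (\sum_(k <oo) (nat_pmf P (X i) k * fine (P (E k)))%:E)%E.
have split C' : measurable C' -> indep_of C' (i :: J) ->
    (P (C' `&` [set w | A [seq X i w | i <- i :: J]]) = P C' * q)%E.
  move=> mC' C'J; have [Ci CiJ] := indep_of_consP _ _ _ iJ C'J.
  rewrite (measure_nat_split _ (X i))//; last first.
    by apply: measurableI => //; exact: measurable_seq_event.
  rewrite -[P C']fineK ?fin_num_measure// -nneseriesZl; last first.
    by move=> k _; rewrite lee_fin mulr_ge0// ?nat_pmf_ge0// fine_ge0.
  apply: eq_eseriesr => k _.
  have -> : C' `&` [set w | A [seq X i w | i <- i :: J]] `&` X i @^-1` [set k] =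
     (C' `&` X i @^-1` [set k]) `&` [set w | A (k :: [seq X i w | i <- J])].
    by apply/seteqP; split=> w /= [[? H1] H2]; [rewrite H2 in H1|rewrite H1].
  have mCk : measurable (C' `&` X i @^-1` [set k]) by exact: measurableI.
  rewrite (IH [set s | A (k :: s)] _ mCk uJ (CiJ k)); last exact: indep_of_tail TJ.
  rewrite Ci nat_pmfE -[P (E k)]fineK ?fin_num_measure//.
  by rewrite -[P C']fineK ?fin_num_measure// -!EFinM mulrA.
rewrite split//; congr (_ * _)%E.
by have := split setT measurableT TJ; rewrite setTI probability_setT mul1e.
Qed.

Lemma nat_rv (Y : T -> nat) : (forall k, measurable (Y @^-1` [set k])) ->
  exists Z : {RV P >-> nat}, Z = Y :> (T -> nat).
Proof.
move=> mY.
have mf : measurable_fun setT Y.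
  move=> _ B _; rewrite setTI (_ : _ @^-1` _ = \bigcup_(k in B) (Y @^-1` [set k])).
    by apply: bigcup_measurable => k _; exact: mY.
  by apply/seteqP; split=> w /=; [move=> BY; exists (Y w)|move=> [k Bk /= ->]].
by exists (mfun_Sub (mem_set mf)).
Qed.

End independence.

(** * Generating functions along the branching recursion *)

Section generating_function_recursion.
Context {R : realType} {d : measure_display} {T : measurableType d}.
Variable P : probability T R.
Variables (xi0 : nat -> {RV P >-> nat}) (xi : nat -> nat -> {RV P >-> nat}).
Variable eps : nat -> {RV P >-> nat}.
Hypothesis xi_eps_indep : mutually_independent gwvei_index (gwvei_family xi eps).
Hypothesis xi_ident : forall n j, (0 < n)%N -> (0 < j)%N ->
  distribution P (xi n j) = distribution P (xi0 n).

Let I := (nat * nat + nat)%type.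
Let fam : I -> {RV P >-> nat} := gwvei_family xi eps.
Let Y (n : nat) : T -> nat := gwvei xi eps n.

Definition offspring_indices (n z : nat) : seq (nat * nat + nat) :=
  [seq inl (n, j) | j <- iota 1 z].

Definition generation_indices (n z : nat) : seq (nat * nat + nat) :=
  inr n :: offspring_indices n z.

(** Variables drawn strictly after generation n; the condition [0 < j] keeps them inside
    [gwvei_index]. *)
Definition later_index (n : nat) (i : nat * nat + nat) : Prop :=
  match i with
  | inl (m, j) => (n < m)%N /\ (0 < j)%N
  | inr m => (n < m)%N
  end.

Lemma uniq_generation n z : uniq (generation_indices n z).
Proof.
rewrite /= map_inj_uniq ?iota_uniq ?andbT; last by move=> x y [].
by apply/negP => /mapP[].
Qed.

Lemma gwveiS n w :
  Y n.+1 w = sumn [seq fam i w | i <- generation_indices n.+1 (Y n w)].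
Proof.
rewrite /= addnC; congr (_ + _)%N.
by rewrite sumnE big_map /offspring_indices big_map /index_iota subSS subn0.
Qed.

Lemma gwvei_given n w z y : Y n w = z ->
  (Y n.+1 w = y) <-> (sumn [seq fam i w | i <- generation_indices n.+1 z] = y).
Proof. by move=> <-; rewrite gwveiS. Qed.

Lemma measurable_gwvei n y : measurable (Y n @^-1` [set y]).
Proof.
elim: n y => [|n IH] y.
  by rewrite /Y/= preimage_cst; case: ifP.
rewrite (_ : _ @^-1` _ = \bigcup_z (Y n @^-1` [set z] `&`
   [set w | [set s | sumn s = y] [seq fam i w | i <- generation_indices n.+1 z]])).
  apply: bigcup_measurable => z _; apply: measurableI; first exact: IH.
  exact: measurable_seq_event.
apply/seteqP; split=> w; last by move=> [z _ [Yz E]]; exact: (gwvei_given _ _ _ _ Yz).2.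
by move=> Yy; exists (Y n w) => //; split=> //; exact: (gwvei_given _ _ _ _ erefl).1.
Qed.

(** The values of [J] are absorbed into the event while [K] remains independent of it; this uses one
    product formula for the whole list [J ++ K]. *)
Lemma indep_of_later n C J K : measurable C ->
  (forall L, uniq L -> (forall i, i \in L -> later_index n i) -> indep_of P _ fam C L) ->
  uniq (J ++ K) -> (forall i, i \in J ++ K -> later_index n i) ->
  forall A, (P (C `&` joint_event P _ fam J A) =
      P C * \prod_(i <- J) P (fam i @^-1` A i))%E /\
    indep_of P _ fam (C `&` joint_event P _ fam J A) K.
Proof.
move=> mC CL uJK JK A.
have E : (P (C `&` joint_event P _ fam J A) = P C * \prod_(i <- J) P (fam i @^-1` A i))%E.
  apply: CL; first by move: uJK; rewrite cat_uniq => /andP[].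
  by move=> i iJ; apply: JK; rewrite mem_cat iJ.
split=> // B; rewrite E -setIA.
have iK i : i \in K -> (i \in J) = false.
  move=> iK; move: uJK; rewrite cat_uniq => /and3P[_ /hasPn/(_ _ iK)/negbTE//].
have := CL _ uJK JK (fun i => if i \in J then A i else B i).
rewrite joint_event_cat.
rewrite (eq_joint_event _ _ _ J _ A); last by move=> i iJ; rewrite iJ.
rewrite (eq_joint_event _ _ _ K _ B); last by move=> i /iK ->.
rewrite big_cat/= => ->; rewrite muleA; congr (_ * _ * _)%E.
  by apply: eq_big_seq => i ->.
by apply: eq_big_seq => i /iK ->.
Qed.

Lemma later_index_S n i : later_index n.+1 i -> later_index n i.
Proof. by case: i => [[m j] /= [/ltnW]|m /= /ltnW]. Qed.

Lemma generation_later n z i : i \in generation_indices n.+1 z -> later_index n i.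
Proof.
rewrite inE => /orP[/eqP->|/mapP[j + ->]]; first exact: ltnSn.
by rewrite mem_iota => /andP[j0 _]; split=> //; exact: ltnSn.
Qed.

Lemma generation_notin_later n z J : (forall i, i \in J -> later_index n.+1 i) ->
  uniq J -> uniq (J ++ generation_indices n.+1 z).
Proof.
move=> JL uJ; rewrite cat_uniq uJ uniq_generation andbT.
apply/hasPn => i; rewrite inE => /orP[/eqP->|/mapP[j _ ->]]; apply/negP => /JL /=.
  by rewrite ltnn.
by rewrite ltnn => -[].
Qed.

(** The event is split along the value z of the previous size; on each piece [Y n.+1] is the sum of
    a fixed finite list of variables, independent of the past by induction and of the later ones. *)
Lemma indep_of_gwvei n y L : uniq L -> (forall i, i \in L -> later_index n i) ->
  indep_of P _ fam (Y n @^-1` [set y]) L.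
Proof.
elim: n y L => [|n IH] y L uL LL A.
  rewrite /Y/= preimage_cst; case: ifP => _; last first.
    by rewrite set0I !measure0 mul0e.
  rewrite setTI probability_setT mul1e.
  apply: (mutually_independent_seq _ _ _ _ _ _ xi_eps_indep); first exact: uL.
  by case=> [[m j]|m] /LL.
have TL z : indep_of P _ fam setT (generation_indices n.+1 z).
  move=> B; rewrite setTI probability_setT mul1e.
  apply: (mutually_independent_seq _ _ _ _ _ _ xi_eps_indep).
    exact: uniq_generation.
  by case=> [[m j]|m] /generation_later /=; [case=> + ->|] => /(leq_ltn_trans (leq0n _)).
pose ev z := [set w | [set s | sumn s = y] [seq fam i w | i <- generation_indices n.+1 z]].
(* The series on the right does not depend on [J] and [B], so the empty list identifies it with the
   probability of [Y n.+1 = y]. *)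
have key J B : uniq J -> (forall i, i \in J -> later_index n.+1 i) ->
   (P (Y n.+1 @^-1` [set y] `&` joint_event P _ fam J B) =
    (\prod_(i <- J) P (fam i @^-1` B i)) *
    \sum_(z <oo) (nat_pmf P (Y n) z * fine (P (ev z)))%:E)%E.
  move=> uJ LJ.
  have mYn k : measurable (Y n @^-1` [set k]) by exact: measurable_gwvei.
  have mJ := measurable_joint_event P _ fam J B.
  have fprod : (\prod_(i <- J) P (fam i @^-1` B i))%E \is a fin_num.
    by rewrite prode_fin_num// => i _; rewrite fin_num_measure//; exact:
      measurable_nat_preimage.
  rewrite (measure_nat_split _ (Y n))//; last first.
    by apply: measurableI => //; exact: measurable_gwvei.
  rewrite -[X in (X * _)%E]fineK// -nneseriesZl; last first.
    by move=> z _; rewrite lee_fin mulr_ge0// fine_ge0.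
  apply: eq_eseriesr => z _.
  have -> : Y n.+1 @^-1` [set y] `&` joint_event P _ fam J B `&` Y n @^-1` [set z] =
    (Y n @^-1` [set z] `&` joint_event P _ fam J B) `&` ev z.
    apply/seteqP; split=> w.
      by move=> [[Yy Jw] Yz]; split=> //; exact: (gwvei_given _ _ _ _ Yz).1.
    by move=> [[Yz Jw] E]; split=> //; split=> //; exact: (gwvei_given _ _ _ _ Yz).2.
  have [E CK] := indep_of_later n _ J (generation_indices n.+1 z) (mYn z) (IH z)
    (generation_notin_later n z J LJ uJ)
    (fun i => ltac:(by rewrite mem_cat => /orP[/LJ/later_index_S|/generation_later])) B.
  rewrite (indep_of_seq_event _ _ _ _ _ _ _ _ CK)//; last 2 first.
  - exact: measurableI.
  - exact: uniq_generation.
  rewrite E -[P (ev z)]fineK; last first.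
    by rewrite fin_num_measure//; exact: measurable_seq_event.
  rewrite -[P (Y n @^-1` [set z])]fineK ?fin_num_measure//.
  rewrite -[X in (_ * X * _)%E]fineK// -!EFinM /nat_pmf; congr EFin; ring.
have N : forall i, i \in [::] -> later_index n.+1 i by [].
have := key [::] A isT N; rewrite big_nil mul1e joint_event_nil setIT => E.
by rewrite key// E muleC.
Qed.

Lemma expectation_offspring n j s : (0 < n)%N -> (0 < j)%N -> 0 <= s <= 1 ->
  ('E_P[fun w => (s ^+ xi n j w)%R] = (nat_pgf P (xi0 n) s)%:E)%E.
Proof.
move=> n0 j0 sI; have /andP[s0 _] := sI.
rewrite -nat_pgfE// /pgf (expectation_ident P _ _ (fun k => s ^+ k) (xi_ident _ _ n0 j0))//.
by move=> k; rewrite exprn_ge0.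
Qed.

(** On the event [Y n = z] the number of summands is fixed, and the integral factors into z
    offspring terms and one immigration term. *)
Lemma nat_pgf_gwveiS n s : 0 <= s <= 1 ->
  nat_pgf P (Y n.+1) s =
  nat_pgf P (Y n) (nat_pgf P (xi0 n.+1) s) * nat_pgf P (eps n.+1) s.
Proof.
move=> sI; have /andP[s0 s1] := sI.
have [Y1 Y1E] := nat_rv P (Y n.+1) (measurable_gwvei n.+1).
have [Y0 Y0E] := nat_rv P (Y n) (measurable_gwvei n).
have fI := nat_pgf_itv P (xi0 n.+1) s sI.
have /andP[f0 f1] := fI.
apply: EFin_inj; rewrite -Y1E -nat_pgfE// /pgf Y1E unlock.
rewrite (ge0_integral_nat_split _ (Y n))//; last 3 first.
- exact: measurable_gwvei.
- by apply/measurable_EFinP; rewrite -Y1E; exact: (measurable_nat_comp _ _ _ (fun k => s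
  ^+ k : R)).
- by move=> w; rewrite lee_fin exprn_ge0.
rewrite -Y0E EFinM -nat_pgfE// /pgf.
rewrite (ge0_expectation_nat P Y0 (fun k => nat_pgf P (xi0 n.+1) s ^+ k)); last first.
  by move=> k; rewrite exprn_ge0.
rewrite muleC -nneseriesZl; last first.
  by move=> k _; rewrite lee_fin mulr_ge0 ?exprn_ge0 ?nat_pmf_ge0.
apply: eq_eseriesr => z _; rewrite setTI Y0E.
transitivity (\int[P]_(w in Y n @^-1` [set z])
   (\prod_(i <- generation_indices n.+1 z) (s ^+ fam i w))%:E)%E.
  apply: eq_integral => w; rewrite inE /= => Yz; congr EFin.
  rewrite gwveiS Yz.
  by rewrite sumnE big_map; exact: (big_morph (fun k => s ^+ k) (exprD s) (expr0 s)).
rewrite (ge0_integral_indep P _ fam _ _ (fun _ k => s ^+ k)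
  (fun i => if i is inl _ then nat_pgf P (xi0 n.+1) s else nat_pgf P (eps n.+1) s));
    first last.
- move=> i; rewrite inE => /orP[/eqP->|/mapP[j + ->]].
    exact: (nat_pgfE P (eps n.+1) s sI).
  by rewrite mem_iota => /andP[j0 _]; exact: expectation_offspring.
- by move=> i k; rewrite exprn_ge0.
- by apply: indep_of_gwvei; [exact: uniq_generation|exact: generation_later].
- exact: uniq_generation.
- exact: measurable_gwvei.
rewrite big_cons big_map big_const_seq count_predT size_iota iter_mulr_1.
rewrite -[P _]fineK ?fin_num_measure//; last exact: measurable_gwvei.
rewrite -!EFinM /nat_pmf; congr EFin; ring.
Qed.

(** The power is the generating function of a sum of j independent offspring numbers; this supplies
    the expansions required by [gfun_comp]. *)
Lemma offspring_pgf_power n j : (0 < n)%N ->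
  exists kappa, gfun R kappa (fun s => nat_pgf P (xi0 n) s ^+ j).
Proof.
move=> n0; pose S w := sumn [seq fam i w | i <- offspring_indices n j].
have mS k : measurable (S @^-1` [set k]).
  exact: (measurable_seq_event P _ fam (offspring_indices n j) [set s | sumn s = k]).
have [Z ZE] := nat_rv P S mS.
exists (nat_pmf P Z); have [c0 cv] := nat_pgf_gfun P Z; split=> // s sI.
have -> : nat_pgf P (xi0 n) s ^+ j = nat_pgf P Z s; last exact: cv.
have /andP[s0 s1] := sI.
have uo : uniq (offspring_indices n j) by have /= /andP[] := uniq_generation n j.
apply: EFin_inj; rewrite -nat_pgfE// /pgf ZE unlock.
transitivity (\int[P]_w (\prod_(i <- offspring_indices n j) (s ^+ fam i w))%:E)%E; last
  first.
  apply: eq_integral => w _; congr EFin.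
  rewrite /S; move: (offspring_indices n j) => J.
  by rewrite sumnE big_map; apply/esym; exact: (big_morph (fun k => s ^+ k) (exprD s)
    (expr0 s)).
rewrite (ge0_integral_indep P _ fam _ _ (fun _ k => s ^+ k)
  (fun i => nat_pgf P (xi0 n) s))//; first last.
- move=> i /mapP[k + ->].
  by rewrite mem_iota => /andP[k0 _]; exact: expectation_offspring.
- by move=> i k; rewrite exprn_ge0.
- move=> A; rewrite setTI probability_setT mul1e.
  apply: (mutually_independent_seq _ _ _ _ _ _ xi_eps_indep); first exact: uo.
  by move=> i /mapP[k + ->]; rewrite mem_iota => /andP[k0 _].
by rewrite probability_setT mul1e big_map big_const_seq count_predT size_iota iter_mulr_1.
Qed.

End generating_function_recursion.

(** * Construction of compound Poisson variables *)

Section unit_interval.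
Variable R : realType.

(** The measure stays on the whole line, so that the rescaling maps below are self-maps; the
    half-open interval is a disjoint union of half-open cells. *)
Definition unit_measure := mrestr (@lebesgue_measure R) (measurable_itv `[0%R, 1%R[).
HB.instance Definition _ := Measure.on unit_measure.

Lemma unit_measure_setT : unit_measure setT = 1%E.
Proof. by rewrite /unit_measure /mrestr setTI lebesgue_measure_itv/= lte_fin ltr01 oppr0
  adde0. Qed.
HB.instance Definition _ :=
  @Measure_isProbability.Build _ _ R unit_measure unit_measure_setT.

Let U : measurableType _ := measurableTypeR R.
Let um : probability U R := unit_measure.

Let affine (p c : R) (x : U) : U := (x - c) / p.

Lemma measurable_affine (p c : R) : measurable_fun setT (affine p c).
Proof. by apply: measurable_funM => //; apply: measurable_funB. Qed.

(** The scaled image measure agrees with Lebesgue measure on half-open intervals, which determine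
    it. *)
Lemma lebesgue_measure_affine (p c : R) (A : set U) : 0 < p -> measurable A ->
  (lebesgue_measure (affine p c @^-1` A) = p%:E * lebesgue_measure A)%E.
Proof.
move=> p0 mA; have pi0 : 0 <= p^-1 by rewrite invr_ge0 ltW.
have mf := measurable_affine p c.
suff -> : (lebesgue_measure A = p^-1%:E * lebesgue_measure (affine p c @^-1` A))%E.
  by rewrite muleA -EFinM divff ?gt_eqF// mul1e.
have := @lebesgue_measure_unique R
  (mscale (NngNum pi0) (pushforward (@lebesgue_measure R) (affine p c))).
move=> /(_ mf) H; apply: H => // _ [[a b]] _ <- /=; rewrite /mscale/= /pushforward.
have -> : affine p c @^-1` `]a, b]%classic = `]a * p + c, b * p + c]%classic.
  apply/seteqP; split=> x /=; rewrite /affine/= !in_itv/=.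
    by rewrite ltr_pdivlMr// ler_pdivrMr// ltrBrDr lerBlDr.
  by rewrite ltr_pdivlMr// ler_pdivrMr// ltrBrDr lerBlDr.
rewrite !lebesgue_measure_itv/= !lte_fin ltrD2r ltr_pM2r//.
case: ifP => // _; last by rewrite mule0.
rewrite -!EFinB -EFinM; congr EFin; field.
by rewrite gt_eqF.
Qed.

Section digit.
Variable w : nat -> R.
Hypothesis w0 : forall j, 0 <= w j.
Hypothesis w1 : \sum_(0 <= j < n) w j @[n --> \oo] --> (1 : R).

Definition cumulative (j : nat) : R := \sum_(0 <= i < j) w i.
Definition cell (j : nat) : set U := `[cumulative j, cumulative j.+1[%classic.
(** Quantile function of the law [w]. Points in no cell, that is outside [0,1), receive the default
    0. *)
Definition digit (x : U) : nat := xget 0%N [set j | cell j x].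
Definition residual (x : U) : U := affine (w (digit x)) (cumulative (digit x)) x.

Lemma cumulativeS j : cumulative j.+1 = cumulative j + w j.
Proof. by rewrite /cumulative big_nat_recr. Qed.

Lemma cumulative_nd i j : (i <= j)%N -> cumulative i <= cumulative j.
Proof.
elim: j => [|j IH]; first by rewrite leqn0 => /eqP->.
rewrite leq_eqVlt => /orP[/eqP->//|ij].
by rewrite (le_trans (IH ij))// cumulativeS lerDl.
Qed.

Lemma cumulative_le1 j : cumulative j <= 1.
Proof.
rewrite -(cvg_lim _ w1)//; apply: nondecreasing_cvgn_le.
  by move=> a b; exact: cumulative_nd.
by apply/cvg_ex; exists 1; exact: w1.
Qed.

Lemma digit_cell j x : cell j x -> digit x = j.
Proof.
rewrite /digit => jx; apply: xget_unique => // i.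
rewrite /cell/= in jx *; rewrite !in_itv/= in jx * => /andP[ix xi].
have /andP[jx' xj] := jx.
apply/eqP; case: ltngtP => // ij.
  by have := lt_le_trans xi (cumulative_nd _ _ ij); rewrite ltNge jx'.
by have := lt_le_trans xj (cumulative_nd _ _ ij); rewrite ltNge ix.
Qed.

Lemma cell_digit x : 0 <= x < 1 -> cell (digit x) x.
Proof.
move=> /andP[x0 x1].
have : exists j, x < cumulative j.+1.
  have [N _ HN] : \forall n \near \oo, x < cumulative n.
    by move: (w1) => /cvgr_gt; apply.
  by exists N; apply: HN; exact: leqnSn.
move=> ex; case: (ex_minnP ex) => j jx jmin.
suff H : cell j x by rewrite (digit_cell j).
rewrite /cell/= in_itv/= jx andbT leNgt; apply/negP.
case: j jmin {jx} => [_|j jmin]; first by rewrite /cumulative big_geq// ltNge x0.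
by move=> /jmin; rewrite ltnn.
Qed.

Lemma measurable_digit j : measurable (digit @^-1` [set j]).
Proof.
have mc i : measurable (cell i) by exact: measurable_itv.
(* The fibre of 0 also contains the points lying in no cell, hence the complement. *)
case: j => [|j].
  rewrite (_ : _ @^-1` _ = ~` \bigcup_j cell j.+1).
    by apply: measurableC; apply: bigcup_measurable.
  apply/seteqP; split=> x /=.
    by move=> d0 [j _ /digit_cell]; rewrite d0.
  move=> Nx; rewrite /digit; case: xgetP => // -[|j] _ //= jx.
  by exfalso; apply: Nx; exists j.
rewrite (_ : _ @^-1` _ = cell j.+1)//.
apply/seteqP; split=> x /=; last exact: digit_cell.
by rewrite /digit; case: xgetP => // y -> /= + yj; rewrite yj.
Qed.

Lemma measurable_residual : measurable_fun setT residual.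
Proof.
move=> _ B mB; rewrite setTI (_ : _ @^-1` _ =
  \bigcup_j (digit @^-1` [set j] `&` affine (w j) (cumulative j) @^-1` B)).
  apply: bigcup_measurable => j _; apply: measurableI; first exact: measurable_digit.
  by rewrite -[X in measurable X]setTI; exact: measurable_affine.
apply/seteqP; split=> x /=; first by exists (digit x).
by move=> [j _ [/= <- ]].
Qed.

Lemma measurable_residual_preimage B : measurable B -> measurable (residual @^-1` B).
Proof. by move=> mB; rewrite -[X in measurable X]setTI; exact: measurable_residual. Qed.

(* Conditionally on the digit, the residual is again uniform, so iterating
   produces infinitely many independent digits. *)
Lemma unit_measure_digit_residual j (B : set U) : measurable B ->
  (um (digit @^-1` [set j] `&` residual @^-1` B) = (w j)%:E * um B)%E.
Proof.
move=> mB.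
(* A zero weight gives an empty cell, for which the rescaling would divide by 0. *)
have [wj0|wj0] := eqVneq (w j) 0.
  rewrite wj0 mul0e [LHS]/(lebesgue_measure _).
  rewrite (_ : _ `&` _ = set0) ?measure0//.
  apply/seteqP; split=> x //= [[dj _]]; rewrite in_itv/= => x01.
  have := cell_digit x x01; rewrite dj /cell/= in_itv/= cumulativeS wj0 addr0.
  by move=> /andP[/le_lt_trans/[apply]]; rewrite ltxx.
have wjp : 0 < w j by rewrite lt_neqAle eq_sym wj0 w0.
rewrite [um B]/(lebesgue_measure _) -(lebesgue_measure_affine _ (cumulative j))//; last
  first.
  exact: measurableI.
rewrite [LHS]/(lebesgue_measure _); congr lebesgue_measure.
have cE x : cell j x <-> 0 <= affine (w j) (cumulative j) x < 1.
  rewrite /cell/= in_itv/= /affine cumulativeS.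
  by rewrite ler_pdivlMr// mul0r subr_ge0 ltr_pdivrMr// mul1r ltrBlDl.
apply/seteqP; split=> x /=.
  move=> [[dj]]; rewrite /residual dj => Bx; rewrite !in_itv/= => x01.
  by split=> //; apply/cE; rewrite -dj; exact: cell_digit.
move=> [Bx]; rewrite !in_itv/= => /cE cx; have dj := digit_cell _ _ cx.
split; first by split=> //; rewrite /residual dj.
move: cx; rewrite /cell/= in_itv/= => /andP[c0 c1].
rewrite (le_trans _ c0)/=; last by rewrite /cumulative sumr_ge0.
exact: lt_le_trans c1 (cumulative_le1 _).
Qed.

Lemma unit_measure_digit j : (um (digit @^-1` [set j]) = (w j)%:E)%E.
Proof.
have := unit_measure_digit_residual j setT measurableT.
by rewrite preimage_setT setIT probability_setT mule1.
Qed.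

Lemma measurable_digit_preimage (A : set nat) : measurable (digit @^-1` A).
Proof.
rewrite (_ : _ @^-1` _ = \bigcup_(j in A) (digit @^-1` [set j])).
  by apply: bigcup_measurable => j _; exact: measurable_digit.
by apply/seteqP; split=> x /=; [move=> Ax; exists (digit x)|move=> [j Aj /= ->]].
Qed.

Lemma digit_residual_indep (A : set nat) (B : set U) : measurable B ->
  (um (digit @^-1` A `&` residual @^-1` B) = um (digit @^-1` A) * um B)%E.
Proof.
move=> mB.
have H B' : measurable B' -> (um (digit @^-1` A `&` residual @^-1` B') =
    \sum_(k <oo) ((if k \in A then w k else 0)%:E * um B'))%E.
  move=> mB'; rewrite (measure_nat_split um digit)//; last 2 first.
  - exact: measurable_digit.
  - by apply: measurableI; [exact: measurable_digit_preimage|exact: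
    measurable_residual_preimage].
  apply: eq_eseriesr => k _; case: ifPn => kA.
    rewrite -unit_measure_digit_residual//; congr (um _).
    apply/seteqP; split=> x /=; first by move=> [[_ ? ->]].
    by move=> [-> ?]; split=> //; split=> //; exact: set_mem.
  rewrite mul0e (_ : _ `&` _ = set0) ?measure0//.
  apply/seteqP; split=> x //= [[Ax _] xk]; move/negP: kA; apply.
  by rewrite -xk; exact/mem_set.
have f0 k : 0 <= if k \in A then w k else 0 by case: ifP.
have := H setT measurableT; rewrite preimage_setT setIT probability_setT => ->.
rewrite H// -[um B]fineK ?fin_num_measure//.
under eq_eseriesr do rewrite muleC.
rewrite nneseriesZl; last by move=> k _; rewrite lee_fin.
by rewrite muleC; congr (_ * _)%E; apply: eq_eseriesr => k _; rewrite mule1.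
Qed.

Lemma unit_measure_residual (B : set U) : measurable B ->
  um (residual @^-1` B) = um B.
Proof.
move=> mB; have := digit_residual_indep setT B mB.
by rewrite preimage_setT setTI probability_setT mul1e.
Qed.

End digit.

(** The weights vary with the position: position 0 will carry the Poisson law and the following ones
    the law of the summands. *)
Fixpoint coordinate (W : nat -> nat -> R) (l : nat) (x : U) : nat :=
  if l is m.+1 then coordinate (fun i => W i.+1) m (residual (W 0%N) x)
  else digit (W 0%N) x.

Definition weights (w : nat -> R) :=
  (forall j, 0 <= w j) /\ \sum_(0 <= j < n) w j @[n --> \oo] --> (1 : R).

Lemma measurable_coordinate W l (A : set nat) : (forall i, weights (W i)) ->
  measurable (coordinate W l @^-1` A).
Proof.
elim: l W => [|l IH] W HW /=.
  by apply: measurable_digit_preimage => //; have [] := HW 0%N.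
have [w0 w1] := HW 0%N.
exact: (measurable_residual_preimage _ w0 _ (IH _ (fun i => HW i.+1))).
Qed.

Lemma coordinate_law W l (A : set nat) : (forall i, weights (W i)) ->
  um (coordinate W l @^-1` A) = um (digit (W l) @^-1` A).
Proof.
elim: l W => [//|l IH] W HW /=.
have [w0 w1] := HW 0%N.
have HW' i : weights (W i.+1) by exact: HW.
have mA : measurable (coordinate (fun i => W i.+1) l @^-1` A).
  exact: measurable_coordinate.
by rewrite (unit_measure_residual _ w0 w1 _ mA) IH.
Qed.

Lemma coordinate_prefix_indep W m (A : nat -> set nat) : (forall i, weights (W i)) ->
  (um (\bigcap_(l in `I_m) coordinate W l @^-1` A l) =
   \prod_(0 <= l < m) um (coordinate W l @^-1` A l))%E.
Proof.
move=> HW; under [RHS]eq_bigr do rewrite coordinate_law//.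
elim: m W A HW => [|m IH] W A HW.
  by rewrite big_geq// II0 bigcap_set0 probability_setT.
have HW' i : weights (W i.+1) by exact: HW.
have [w0 w1] := HW 0%N.
rewrite big_nat_recl//= -(IH (fun i => W i.+1) (fun l => A l.+1))//.
rewrite -digit_residual_indep//; last first.
  by apply: bigcap_measurableType => l _; exact: measurable_coordinate.
congr (um _); apply/seteqP; split=> x /=.
  by move=> H; split; [exact: (H 0%N)|move=> l /= lm; exact: (H l.+1)].
by move=> [H0 H] [|l] //= lm; exact: H.
Qed.

Lemma coordinate_rv W l : (forall i, weights (W i)) ->
  exists X : {RV um >-> nat}, X = coordinate W l :> (U -> nat).
Proof. by move=> HW; apply: nat_rv => k; exact: measurable_coordinate. Qed.

Lemma coordinate_indep W (L : seq nat) (A : nat -> set nat) :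
  (forall i, weights (W i)) -> uniq L ->
  (um (\bigcap_(l in [set` L]) coordinate W l @^-1` A l) =
   \prod_(l <- L) um (coordinate W l @^-1` A l))%E.
Proof.
move=> HW uL; pose m := (\max_(l <- L) l).+1.
have Lm l : l \in L -> (l < m)%N by move=> lL; rewrite ltnS; exact: leq_bigmax_seq.
have := coordinate_prefix_indep W m (fun l => if l \in L then A l else setT) HW.
have -> : \bigcap_(l in `I_m) coordinate W l @^-1` (if l \in L then A l else setT) =
   \bigcap_(l in [set` L]) coordinate W l @^-1` A l.
  apply/seteqP; split=> x H l /= lL; first by have := H l (Lm l lL); rewrite /= lL.
  by case: ifP => // /H.
move=> ->; have -> : (\prod_(l <- L) um (coordinate W l @^-1` A l) =
    \prod_(l <- index_iota 0 m | l \in L) um (coordinate W l @^-1` A l))%E.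
  rewrite -[RHS]big_filter; apply: perm_big; apply: uniq_perm => //.
    exact/filter_uniq/iota_uniq.
  move=> l; rewrite mem_filter mem_index_iota /=.
  by have [/Lm|] := boolP (l \in L).
rewrite [RHS]big_mkcond; apply: eq_bigr => l _.
by case: ifP => // _; rewrite preimage_setT probability_setT.
Qed.

End unit_interval.

(** * Compound Poisson variables from independent digits *)

Section compound_poisson.
Variable R : realType.
Let um : probability (measurableTypeR R) R := unit_measure R.

Lemma coordinate_pmf (W : nat -> nat -> R) l (A : set nat) :
  (forall i, weights R (W i)) ->
  (um (coordinate R W l @^-1` A) = \sum_(k <oo) (if k \in A then W l k else 0)%:E)%E.
Proof.
move=> HW; have [w0 w1] := HW l.
rewrite coordinate_law// (measure_nat_split um (digit R (W l)))//; last 2 first.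
- by move=> k; exact: measurable_digit.
- exact: measurable_digit_preimage.
apply: eq_eseriesr => k _; case: ifPn => kA.
  rewrite -unit_measure_digit//; congr (um _).
  by apply/seteqP; split=> x /=; [move=> []|move=> ->; split=> //; exact: set_mem].
rewrite (_ : _ `&` _ = set0) ?measure0//.
apply/seteqP; split=> x //= [Ax xk]; move/negP: kA; apply.
by rewrite -xk; exact/mem_set.
Qed.

Lemma weights_poisson (rate : R) : 0 < rate -> weights R (poisson_pmf rate).
Proof.
move=> r0; split=> [j|]; first exact: poisson_pmf_ge0.
apply/nneseries_EFinP; first by move=> j; exact: poisson_pmf_ge0.
have : poisson_prob rate 0%N setT = 1%E by exact: probability_setT.
rewrite /poisson_prob r0 => <-; rewrite -nneseries_esumT//.
by move=> *; rewrite lee_fin poisson_pmf_ge0.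
Qed.

Lemma poisson_probE (rate : R) (A : set nat) : 0 < rate ->
  (poisson_prob rate 0%N A = \sum_(k <oo) (if k \in A then poisson_pmf rate k else 0)%:E)%E.
Proof.
move=> r0.
have E B : (poisson_prob rate 0%N B = \esum_(k in B) (poisson_pmf rate k)%:E)%E.
  by rewrite /poisson_prob r0.
transitivity (\sum_(k <oo) poisson_prob rate 0%N (A `&` [set k]))%E.
  exact: (measure_nat_split (poisson_prob rate 0%N) id).
apply: eq_eseriesr => k _; rewrite E; case: ifPn => kA.
  have -> : A `&` [set k] = [set k].
    by apply/seteqP; split=> x /=; [case|move=> ->; split=> //; exact: set_mem].
  by rewrite esum_set1// lee_fin poisson_pmf_ge0.
rewrite (_ : _ `&` _ = set0) ?esum_set0//.
apply/seteqP; split=> x //= [Ax xk]; move/negP: kA; apply.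
by rewrite -xk; exact/mem_set.
Qed.

Lemma poisson_pgf (rate t : R) : 0 < rate -> 0 <= t ->
  (\sum_(n <oo) (t ^+ n * poisson_pmf rate n)%:E = (expR (- (rate - rate * t)))%:E)%E.
Proof.
move=> r0 t0; apply/nneseries_EFinP.
  by move=> n; rewrite mulr_ge0 ?exprn_ge0// poisson_pmf_ge0.
rewrite opprB expRD.
have -> : (fun n => \sum_(0 <= j < n) t ^+ j * poisson_pmf rate j) =
  (fun n => series (exp_coeff (rate * t)) n * expR (- rate)).
  apply/funext => n; rewrite /series/= mulr_suml; apply: eq_bigr => j _.
  by rewrite /poisson_pmf r0 /exp_coeff /= exprMn; ring.
by apply: cvgMl; exact: is_cvg_series_exp_coeff.
Qed.

(** The target is the Poisson generating function at [g s / rate]: the number of summands has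
    parameter [rate], each summand has the weights [r j / rate], and [g 1 = rate] is their
    normalisation. *)
Lemma compound_poisson_exists (r : nat -> R) (g : R -> R) (rate : R) :
  gfun R r g -> 0 < rate -> g 1 = rate ->
  exists (d' : measure_display) (T' : measurableType d') (P' : probability T' R)
    (Y : {RV P' >-> nat}), compound_poisson Y /\
    forall s, 0 <= s <= 1 -> nat_pgf P' Y s = expR (- (rate - g s)).
Proof.
move=> rg rate0 g1; have [r0 cv] := rg.
pose W i := if i is 0%N then poisson_pmf rate else (fun j => r j / rate).
have HW i : weights R (W i).
  case: i => [|i]; first exact: weights_poisson.
  split=> [j|]; first by rewrite divr_ge0// ltW.
  have one01 : 0 <= (1 : R) <= 1 by rewrite ler01 lexx.
  have -> : (1 : R) = g 1 / rate by rewrite g1 divff// gt_eqF.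
  have -> : (fun n => \sum_(0 <= j < n) r j / rate) =
     (fun n => (\sum_(0 <= j < n) r j * 1 ^+ j) / rate).
    apply/funext => n; rewrite mulr_suml; apply: eq_bigr => j _.
    by rewrite expr1n mulr1.
  by apply: cvgMl; exact: cv.
have /choice[X XE] : forall l, exists X : {RV um >-> nat}, X = coordinate R W l :> (_ ->
  nat).
  by move=> l; exact: coordinate_rv.
have Xind L A : uniq L -> (um (joint_event um _ X L A) = \prod_(l <- L) um (X l @^-1` A
  l))%E.
  move=> uL; have := coordinate_indep R W L A HW uL.
  have -> : (\prod_(l <- L) um (coordinate R W l @^-1` A l) =
    \prod_(l <- L) um (X l @^-1` A l))%E by apply: eq_bigr => l _; rewrite XE.
  move=> <-; congr (um _); apply: eq_bigcapr => l _; by rewrite XE.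
pose Yf x := (\sum_(i < X 0%N x) X i.+1 x)%N.
have YfE n x : X 0%N x = n -> Yf x = sumn [seq X i x | i <- iota 1 n].
  move=> <-; rewrite sumnE big_map /Yf -[1%N]addn0 iotaDl big_map.
  by rewrite -(big_mkord xpredT (fun i => X i.+1 x)) /index_iota subn0.
have [Y YE] : exists Y : {RV um >-> nat}, Y = Yf :> (_ -> nat).
  apply: nat_rv => y.
  rewrite (_ : _ @^-1` _ = \bigcup_n (X 0%N @^-1` [set n] `&`
     [set x | [set s | sumn s = y] [seq X i x | i <- iota 1 n]])).
    apply: bigcup_measurable => n _; apply: measurableI.
      exact: measurable_nat_preimage.
    exact: measurable_seq_event.
  apply/seteqP; split=> x /=.
    by move=> <-; exists (X 0%N x) => //; split=> //=; rewrite -YfE.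
  by move=> [n _ [/= Xn]]; rewrite -YfE.
exists _, (measurableTypeR R), um, Y; split.
  exists _, (measurableTypeR R), um, (X 0%N), (fun i => X i.+1), rate; split.
  - exact: ltW.
  - apply/funext => A; rewrite poisson_probE//.
    by rewrite -(coordinate_pmf W 0 A HW) -XE.
  - move=> i; apply/funext => A.
    transitivity (um (X i.+1 @^-1` A)); first by [].
    transitivity (um (X 1%N @^-1` A)); last by [].
    by rewrite !XE !coordinate_pmf.
  - move=> J A _.
    pose f o := if o is Some i then i.+1 else 0%N.
    pose B l := if l is i.+1 then A (Some i) else A None.
    have := Xind [seq f o | o <- enum_fset J] B.
    rewrite map_inj_uniq ?fset_uniq; last by move=> [x|] [y|] //= [->].
    move=> /(_ isT); rewrite big_map.
    have -> : joint_event um _ X [seq f o | o <- enum_fset J] B =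
      \bigcap_(i in [set` J]) ((if i is Some i0 then X i0.+1 else X 0%N) @^-1` A i).
      apply/seteqP; split=> x H.
        by move=> [i|] iJ; [exact: (H i.+1 (map_f f iJ))|exact: (H 0%N (map_f f iJ))].
      by move=> l /= /mapP[[i|] iJ ->]; exact: (H _ iJ).
    move=> H; apply: (etrans _ (etrans H _)); last by apply: eq_bigr => -[i|] _.
    by congr (um _); apply: eq_bigcapr => -[i|] _.
  - by move=> A; rewrite YE.
move=> s sI; have /andP[s0 s1] := sI.
have gs0 : 0 <= g s / rate by rewrite divr_ge0 ?(ltW rate0)// (gfun_ge0 _ _ _ _ rg).
apply: EFin_inj; rewrite -nat_pgfE// /pgf unlock YE.
have -> : rate - g s = rate - rate * (g s / rate) by rewrite mulrCA divff ?mulr1// gt_eqF.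
rewrite -poisson_pgf// (ge0_integral_nat_split um (X 0%N))//; last 3 first.
- by move=> k; exact: measurable_nat_preimage.
- by apply/measurable_EFinP; rewrite -YE; exact: (measurable_nat_comp _ _ _ (fun k => s
  ^+ k : R)).
- by move=> x; rewrite lee_fin exprn_ge0.
apply: eq_eseriesr => n _; rewrite setTI.
transitivity (\int[um]_(x in X 0%N @^-1` [set n]) (\prod_(i <- iota 1 n) (s ^+ X i
  x))%:E)%E.
  apply: eq_integral => x; rewrite inE /= => Xn; congr EFin.
  rewrite (YfE n)// sumnE big_map.
  exact: (big_morph (fun k => s ^+ k) (exprD s) (expr0 s)).
have Xlaw l k : nat_pmf um (X l) k = W l k.
  apply: EFin_inj; rewrite -nat_pmfE XE coordinate_law//.
  by have [w0 w1] := HW l; exact: unit_measure_digit.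
rewrite (ge0_integral_indep um _ X _ _ (fun _ k => s ^+ k) (fun=> g s / rate)); first last.
- move=> i; rewrite mem_iota => /andP[i0 _].
  rewrite (ge0_expectation_nat um (X i) (fun k => s ^+ k)); last first.
    by move=> k; rewrite exprn_ge0.
  apply/nneseries_EFinP; first by move=> k; rewrite mulr_ge0 ?exprn_ge0 ?nat_pmf_ge0.
  have -> : (fun n => \sum_(0 <= j < n) s ^+ j * nat_pmf um (X i) j) =
     (fun n => (\sum_(0 <= j < n) r j * s ^+ j) / rate).
    apply/funext => n'; rewrite mulr_suml; apply: eq_bigr => j _.
    by rewrite Xlaw; case: i i0 => // i _ /=; ring.
  by apply: cvgMl; exact: cv.
- by move=> i k; rewrite exprn_ge0.
- move=> A.
  (* Adding position 0 with the singleton [[set n]] turns joint independence into independence of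
     the event that there are n summands from these summands. *)
  have := Xind (0%N :: iota 1 n) (fun i => if i is 0%N then [set n] else A i).
  rewrite /= iota_uniq mem_iota/= => /(_ isT).
  rewrite joint_event_cons big_cons.
  rewrite (eq_joint_event _ _ _ (iota 1 n) _ A); last first.
    by move=> i; rewrite mem_iota => /andP[]; case: i.
  move=> ->; congr (_ * _)%E; apply: eq_big_seq => i.
  by rewrite mem_iota => /andP[]; case: i.
- exact: iota_uniq.
- exact: measurable_nat_preimage.
rewrite big_const_seq count_predT size_iota iter_mulr_1.
by rewrite nat_pmfE Xlaw -EFinM mulrC.
Qed.

End compound_poisson.

(** * Convergence in distribution *)

Lemma limn_esup_root_pow_cvg0 (R : realType) (lam : nat -> R) (u : R) :
  (forall k, (0 < k)%N -> 0 <= lam k) ->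
  (limn_esup (fun n => (lam n `^ n%:R^-1)%:E) <= 1)%E -> 0 <= u < 1 ->
  lam k * u ^+ k @[k --> \oo] --> 0.
Proof.
move=> lam0 Hlam /andP[u0 u1].
have u10 : 0 < 1 + u by rewrite ltr_pwDl.
(* Root test: any [rho > 1] with [rho * u < 1] works; this choice also makes sense for u = 0. *)
pose rho := 2 / (1 + u).
have rho1 : 1 < rho by rewrite ltr_pdivlMr// mul1r; lra.
have rho0 : 0 <= rho by rewrite ltW// (lt_trans ltr01).
have rhou : rho * u < 1 by rewrite mulrAC ltr_pdivrMr// mul1r; lra.
set v := (fun n => _) in Hlam.
have : (ereal_inf (range (esups v)) < rho%:E)%E.
  by rewrite -(cvg_lim _ (@cvg_esups_inf R v))// -limn_esup_lim (le_lt_trans Hlam)//.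
move=> /ereal_inf_lt[_ [N _ <-] HN].
(* The strict inequality ensures n > 0; for n = 0 the exponent [n%:R^-1] would be 0 and the root
   would forget [lam n]. *)
have bound n : (N < n)%N -> lam n <= rho ^+ n.
  move=> Nn; have n0 : (0 < n)%N by apply: leq_ltn_trans Nn.
  have : (v n <= rho%:E)%E.
    apply: le_trans (ltW HN); apply: ereal_sup_ubound.
    by exists n => //=; exact: ltnW.
  rewrite lee_fin => H.
  have -> : lam n = (lam n `^ n%:R^-1) ^+ n.
    rewrite -powR_mulrn ?powR_ge0// -powRrM mulVf ?powRr1 ?lam0//.
    by rewrite pnatr_eq0 -lt0n.
  by rewrite lerXn2r// nnegrE powR_ge0.
apply: (@squeeze_cvgr _ _ _ _ (fun=> 0) (fun n => (rho * u) ^+ n)).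
- near=> n; have Nn : (N < n)%N by near: n; exists N.+1.
  have n0 : (0 < n)%N by apply: leq_ltn_trans Nn.
  rewrite mulr_ge0 ?lam0 ?exprn_ge0//= exprMn ler_wpM2r ?exprn_ge0//.
  exact: bound.
- exact: cvg_cst.
- by apply: cvg_expr; rewrite ger0_norm// mulr_ge0.
Unshelve. all: by end_near. Qed.

(** A finite limit of the quotient excludes the value +oo of [e n] from some rank on; finiteness of
    the moments is thus drawn from the limits. *)
Lemma ereal_ratio_cvg (R : realType) (e : nat -> \bar R) (b : nat -> R) (l : R) :
  (forall n, (0 < n)%N -> (0 <= e n)%E) -> (forall n, (0 < n)%N -> 0 < b n) ->
  (e n / (b n)%:E)%E @[n --> \oo] --> l%:E ->
  forall d, 0 < d -> \forall n \near \oo,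
    e n \is a fin_num /\ `|fine (e n) - l * b n| <= d * b n.
Proof.
move=> e0 b0 /fine_cvgP[fin cv] d d0.
move/cvgrPdist_le : cv => /(_ _ d0) cv.
near=> n.
have n0 : (0 < n)%N by near: n; exists 1%N.
have bn := b0 _ n0.
have fn : (e n / (b n)%:E)%E \is a fin_num by near: n.
have en : e n \is a fin_num.
  have := e0 _ n0; move: fn; rewrite inver gt_eqF//.
  by case: (e n) => [r||]//; rewrite mulyr gtr0_sg ?invr_gt0// mul1e.
split=> //.
have : `|l - fine (e n / (b n)%:E)%E| <= d by near: n.
rewrite inver gt_eqF// -[X in fine (X * _)%E]fineK// -EFinM /= => H.
have -> : fine (e n) - l * b n = - ((l - fine (e n) / b n) * b n).
  by field; rewrite gt_eqF.
by rewrite normrN normrM (gtr0_norm bn) ler_pM2r.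
Unshelve. all: by end_near. Qed.

Section weak_convergence.
Context {R : realType}.

(** The terms beyond [J] weigh at most [B] times the remaining mass. *)
Lemma gfun_bounded_dist (c : nat -> R) (F : R -> R) (psi : nat -> R) (B e : R) (J : nat) :
  gfun R c F -> F 1 = 1 -> (forall k, 0 <= psi k <= B) ->
  \sum_(0 <= k < n) psi k * c k @[n --> \oo] --> e ->
  `|e - \sum_(0 <= k < J) psi k * c k| <= B * (1 - \sum_(0 <= k < J) c k).
Proof.
move=> cF F1 psiB cv; have [c0 _] := cF.
have one01 : 0 <= (1 : R) <= 1 by rewrite ler01 lexx.
have c1 n : \sum_(0 <= k < n) c k <= 1.
  rewrite -[leRHS]F1 (le_trans _ (gfun_partial_le _ _ _ _ n cF one01))//.
  by under [leRHS]eq_bigr do rewrite expr1n mulr1.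
have B0 : 0 <= B by have /andP[/le_trans] := psiB 0%N; apply.
have C : `|\sum_(0 <= k < n) psi k * c k - \sum_(0 <= k < J) psi k * c k| @[n --> \oo] -->
   `|e - \sum_(0 <= k < J) psi k * c k|.
  by apply: cvg_norm; apply: cvgB => //; exact: cvg_cst.
rewrite -(cvg_lim _ C)//; apply: limr_le; first by apply/cvg_ex; eexists; exact: C.
near=> n; have Jn : (J <= n)%N by near: n; exists J.
rewrite (@big_cat_nat _ _ _ J 0 n)//= addrAC subrr add0r ger0_norm; last first.
  by rewrite sumr_ge0// => i _; rewrite mulr_ge0//; have /andP[] := psiB i.
apply: (@le_trans _ _ (\sum_(J <= i < n) B * c i)).
  by apply: ler_sum => i _; rewrite ler_wpM2r//; have /andP[] := psiB i.
rewrite -mulr_sumr ler_wpM2l// lerBrDl (le_trans _ (c1 n))//.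
by rewrite [leRHS](@big_cat_nat _ _ _ J 0 n).
Unshelve. all: by end_near. Qed.

(** Adding [B] makes the integrand nonnegative, so that its expectation is a series of nonnegative
    terms; the total mass 1 undoes the shift. *)
Lemma bounded_expectation (d : measure_display) (T : measurableType d)
    (P : probability T R) (X : {RV P >-> nat}) (psi : nat -> R) (B : R) :
  (forall k, `|psi k| <= B) ->
  exists e : R, 'E_P[fun w => psi (X w)]%E = (e - B)%:E /\
    \sum_(0 <= k < n) (psi k + B) * nat_pmf P X k @[n --> \oo] --> e.
Proof.
move=> psiB.
have pB k : 0 <= psi k + B <= 2 * B.
  by have := psiB k; rewrite ler_norml => /andP[? ?]; apply/andP; split; lra.
have B0 : 0 <= 2 * B by have /andP[/le_trans] := pB 0%N; apply.
have i1 (phi : nat -> R) M : (forall k, `|phi k| <= M) ->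
    P.-integrable setT (EFin \o (fun w => phi (X w))).
  move=> phiM; apply: (@le_integrable _ _ _ P setT measurableT _ (EFin \o cst M)).
  - by apply/measurable_EFinP; exact: (measurable_nat_comp _ _ _ phi).
  - by move=> w _ /=; rewrite lee_fin (le_trans (phiM _))// ler_norm.
  exact: finite_measure_integrable_cst.
have j1 := i1 _ _ psiB.
have j2 : P.-integrable setT (EFin \o (fun w => psi (X w) + B)).
  by apply: (i1 (fun k => psi k + B) (2 * B)) => k; have /andP[? ?] := pB k; rewrite
    ger0_norm.
have j3 : P.-integrable setT (EFin \o (fun _ : T => B)) by exact:
  finite_measure_integrable_cst.
exists (\int[P]_w (psi (X w) + B))%R; split.
  have -> : (\int[P]_w (psi (X w) + B))%R - B = (\int[P]_w psi (X w))%R.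
    rewrite RintegralD// Rintegral_cst//; have -> : fine (P setT) = 1 by rewrite
      probability_setT.
    by rewrite mulr1 addrK.
  by rewrite /Rintegral fineK ?unlock//; exact: integrable_fin_num.
apply/nneseries_EFinP.
  by move=> k; rewrite mulr_ge0 ?nat_pmf_ge0//; have /andP[] := pB k.
rewrite -ge0_expectation_nat; last by move=> k; have /andP[] := pB k.
by rewrite /Rintegral fineK ?unlock//; exact: integrable_fin_num.
Qed.

(** No mass escapes because the limit is itself a probability law: if the first [J] atoms carry
    almost all the mass of [Y], they eventually carry almost all that of [X n]. *)
Lemma cvg_in_distribution_pmf (d d' : measure_display) (T : measurableType d)
    (T' : measurableType d') (P : probability T R) (P' : probability T' R)
    (X : nat -> {RV P >-> nat}) (Y : {RV P' >-> nat}) :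
  (forall j, nat_pmf P (X n) j @[n --> \oo] --> nat_pmf P' Y j) ->
  cvg_in_distribution P P' X Y.
Proof.
move=> XY g _ [M gM].
pose psi k := g k%:R.
have psiM k : `|psi k| <= M by exact: gM.
have pM k : 0 <= psi k + M <= 2 * M.
  by have := psiM k; rewrite ler_norml => /andP[? ?]; apply/andP; split; lra.
have M0 : 0 <= 2 * M by have /andP[/le_trans] := pM 0%N; apply.
have /choice[e eP] := fun n => bounded_expectation _ _ P (X n) psi M psiM.
have [f [fE fP]] := bounded_expectation _ _ P' Y psi M psiM.
have -> : (fun n => 'E_P[(fun w => g (X n w)%:R)]%E) = (fun n => (e n - M)%:E).
  by apply/funext => n; have [<- _] := eP n.
rewrite fE.
suff ef : e n @[n --> \oo] --> f.
  by apply: cvg_EFin; [exact: nearW|apply: cvgB => //; exact: cvg_cst].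
apply/cvgrPdist_le => eta eta0.
have one01 : 0 <= (1 : R) <= 1 by rewrite ler01 lexx.
(* The error splits into the tail of [Y] (eta/4), the first [J] atoms (eta/4) and the tail of [X n]
   (eta/2). The shifted function takes values between 0 and [2 * M], hence the denominator. *)
have eta40 : 0 < eta / 4 / (2 * M + 1) by rewrite !divr_gt0// ltr_wpDl.
have [_ /(_ _ one01)] := nat_pgf_gfun P' Y; rewrite nat_pgf1.
move/cvgrPdist_le => /(_ _ eta40)[J _ /(_ _ (leqnn J))].
move=> /(le_trans (ler_norm _)).
under eq_bigr do rewrite expr1n mulr1.
move=> HJ.
have C1 : \sum_(0 <= k < J) nat_pmf P (X n) k @[n --> \oo] -->
    \sum_(0 <= k < J) nat_pmf P' Y k.
  elim: (J) => [|K IH].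
    by under eq_fun do rewrite big_geq//; rewrite big_geq//; exact: cvg_cst.
  under eq_fun do rewrite big_nat_recr//=; rewrite big_nat_recr//=.
  exact: cvgD.
have C2 : \sum_(0 <= k < J) (psi k + M) * nat_pmf P (X n) k @[n --> \oo] -->
    \sum_(0 <= k < J) (psi k + M) * nat_pmf P' Y k.
  elim: (J) => [|K IH].
    by under eq_fun do rewrite big_geq//; rewrite big_geq//; exact: cvg_cst.
  under eq_fun do rewrite big_nat_recr//=; rewrite big_nat_recr//=.
  by apply: cvgD => //; apply: cvgMr; exact: XY.
have eta4' : 0 < eta / 4 by rewrite divr_gt0.
move/cvgrPdist_le : C1 => /(_ _ eta40) C1.
move/cvgrPdist_le : C2 => /(_ _ eta4') C2.
near=> n.
have D1 : `|\sum_(0 <= k < J) nat_pmf P' Y k - \sum_(0 <= k < J) nat_pmf P (X n) k| <=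
  eta / 4 / (2 * M + 1) by near: n.
have D2 : `|\sum_(0 <= k < J) (psi k + M) * nat_pmf P' Y k -
   \sum_(0 <= k < J) (psi k + M) * nat_pmf P (X n) k| <= eta / 4 by near: n.
have [_ en] := eP n.
have A1 := gfun_bounded_dist _ _ _ _ _ J (nat_pgf_gfun P (X n)) (nat_pgf1 P (X n)) pM en.
have A2 := gfun_bounded_dist _ _ _ _ _ J (nat_pgf_gfun P' Y) (nat_pgf1 P' Y) pM fP.
move: HJ D1 D2 A1 A2.
set x := \sum_(0 <= k < J) nat_pmf P' Y k; set y := \sum_(0 <= k < J) nat_pmf P (X n) k.
set z := \sum_(0 <= k < J) (psi k + M) * nat_pmf P' Y k.
set t := \sum_(0 <= k < J) (psi k + M) * nat_pmf P (X n) k.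
move=> HJ D1 D2 A1 A2.
have D1' := le_trans (ler_norm _) D1.
have S : 2 * M * (eta / 4 / (2 * M + 1)) <= eta / 4.
  rewrite mulrA ler_pdivrMr ?ltr_wpDl// mulrC ler_wpM2l ?(ltW eta4')//.
  by rewrite lerDl.
have E1 : 2 * M * (1 - x) <= eta / 4.
  by rewrite (le_trans _ S)// ler_wpM2l.
have E2 : 2 * M * (1 - y) <= eta / 4 + eta / 4.
  rewrite (le_trans _ (lerD S S))// -mulrDr ler_wpM2l//.
  move: (eta / 4 / (2 * M + 1)) HJ D1' => w HJ D1'; lra.
have -> : f - e n = (f - z) + (z - t) - (e n - t) by ring.
rewrite (le_trans (ler_normB _ _))// (le_trans (lerD (ler_normD _ _) (lexx _)))//.
lra.
Unshelve. all: by end_near. Qed.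

End weak_convergence.

(** * Proof of the theorem *)

Section gwvei_limit_theorem.
Context {R : realType} {d : measure_display} {T : measurableType d}.
Variable P : probability T R.
Variables (xi0 : nat -> {RV P >-> nat}) (xi : nat -> nat -> {RV P >-> nat}).
Variable eps : nat -> {RV P >-> nat}.
Variables (nu : R) (lam : nat -> R).
Hypothesis xi_eps_indep : mutually_independent gwvei_index (gwvei_family xi eps).
Hypothesis xi_ident : forall n j, (0 < n)%N -> (0 < j)%N ->
  distribution P (xi n j) = distribution P (xi0 n).
Hypothesis C1_lt1 : forall n, (0 < n)%N -> (mean (xi0 n) < 1)%E.
Hypothesis C1_lim : mean (xi0 n) @[n --> \oo] --> 1%E.
Hypothesis C1_sum : (\sum_(1 <= n <oo) (1 - mean (xi0 n)) = +oo)%E.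
Hypothesis nu_ge0 : 0 <= nu.
Hypothesis C2 : (fact_moment 2 (xi0 n) / (1 - mean (xi0 n)))%E @[n --> \oo]
  --> nu%:E.
Hypothesis C3 : 0 < nu ->
  (fact_moment 3 (xi0 n) / (1 - mean (xi0 n)))%E @[n --> \oo] --> 0%E.
Hypothesis lam_ge0 : forall k, (0 < k)%N -> 0 <= lam k.
Hypothesis lam_lim : forall k, (0 < k)%N ->
  (fact_moment k (eps n) / (k`!%:R%:E * (1 - mean (xi0 n))))%E
    @[n --> \oo] --> (lam k)%:E.
Hypothesis lam_limsup : (limn_esup (fun n => (lam n `^ n%:R^-1)%:E) <= 1)%E.

Let a n := 1 - fine (mean (xi0 n)).
Let h n u := 1 - nat_pgf P (xi0 n) (1 - u).
Let q n u := 1 - nat_pgf P (eps n) (1 - u).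

Lemma fact_moment_ge0 k (X : {RV P >-> nat}) : (0 <= fact_moment k X)%E.
Proof. by apply: expectation_ge0. Qed.

Lemma fact_moment1 (X : {RV P >-> nat}) : fact_moment 1 X = mean X.
Proof.
rewrite /fact_moment /mean; congr expectation.
by apply/funext => w; rewrite ffactn1.
Qed.

Lemma fact_moment0 (X : {RV P >-> nat}) : fact_moment 0 X = 1%E.
Proof.
rewrite /fact_moment; under [X in 'E_P[X]%E]eq_fun do rewrite ffactn0.
exact: (expectation_cst P 1).
Qed.

Lemma mean_fin_num n : (0 < n)%N -> mean (xi0 n) \is a fin_num.
Proof.
move=> n0; rewrite ge0_fin_numE; first by rewrite (lt_trans (C1_lt1 _ n0))// ltry.
by rewrite -fact_moment1 fact_moment_ge0.
Qed.

Lemma one_sub_meanE n : (0 < n)%N -> (1 - mean (xi0 n))%E = (a n)%:E.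
Proof. by move=> n0; rewrite /a EFinB fineK// mean_fin_num. Qed.

Lemma one_sub_mean_itv n : (0 < n)%N -> 0 < a n <= 1.
Proof.
move=> n0; apply/andP; split.
  by rewrite -lte_fin -one_sub_meanE// sube_gt0 C1_lt1.
by rewrite gerBl fine_ge0// -fact_moment1 fact_moment_ge0.
Qed.

Lemma one_sub_mean_cvg0 : a n @[n --> \oo] --> 0.
Proof.
have -> : 0 = 1 - 1 :> R by rewrite subrr.
by apply: cvgB; [exact: cvg_cst|exact: fine_cvg C1_lim].
Qed.

Lemma one_sub_mean_sum : \sum_(0 <= k < n) a k.+1 @[n --> \oo] --> +oo.
Proof.
apply/cvgeryP.
have E : (fun n => \sum_(1 <= k < n.+1) (1 - mean (xi0 k)))%E =
   (fun n => (\sum_(0 <= k < n) a k.+1)%:E).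
  apply/funext => n; rewrite big_add1/= -sumEFin; apply: eq_bigr => k _.
  exact: one_sub_meanE.
rewrite -E (cvg_shiftS (fun n => \sum_(1 <= k < n) (1 - mean (xi0 k)))%E).
have : cvgn (fun n => \sum_(1 <= k < n) (1 - mean (xi0 k)))%E.
  apply: is_cvg_nneseries => n n1 _; rewrite one_sub_meanE// lee_fin.
  by have /andP[/ltW] := one_sub_mean_itv _ n1.
by move=> /cvg_ex[l cl]; move: (cl); rewrite -(cvg_lim _ cl)// C1_sum.
Qed.

Lemma one_sub_pgf_itv (X : {RV P >-> nat}) u : 0 <= u <= 1 -> 0 <= 1 - nat_pgf P X (1 -
  u) <= 1.
Proof.
move=> /andP[u0 u1].
have /andP[p0 p1] : 0 <= nat_pgf P X (1 - u) <= 1.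
  by apply: nat_pgf_itv; rewrite subr_ge0 u1 gerBl.
by rewrite subr_ge0 p1 gerBl.
Qed.

(** Bonferroni inequality of order 1, where the mean is the remainder. *)
Lemma offspring_contraction n u : (0 < n)%N -> 0 <= u <= 1 -> 0 <= h n u <= (1 - a n) * u.
Proof.
move=> n0 uI; have /andP[-> _] := one_sub_pgf_itv (xi0 n) u uI; rewrite andTb.
have fin k : (0 < k <= 1)%N -> fact_moment k (xi0 n) \is a fin_num.
  by rewrite andbC -eqn_leq => /eqP->; rewrite fact_moment1 mean_fin_num.
have := pgf_expansion P (xi0 n) 1 u fin uI.
rewrite big_nat1 fact_moment0 fact_moment1 fact0 !expr0 divr1 !mulr1 divr1 expr1.
rewrite -normrN opprB => /(le_trans (ler_norm _)).
by rewrite /a subKr.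
Qed.

(** The order of the expansion depends on [nu]. For [nu = 0] the second moment is negligible before
    [a n] and serves as remainder, the third being uncontrolled; for [nu > 0] it is a main term and
    (C3) makes the third moment the remainder. *)
Lemma offspring_expansion e : 0 < e -> \forall n \near \oo, forall u, 0 <= u <= 1 ->
  `|u - h n u - a n * (u + nu / 2 * u ^+ 2)| <= e * a n * u.
Proof.
move=> e0.
have R2 : (fact_moment 2 (xi0 n) / (a n)%:E)%E @[n --> \oo] --> nu%:E.
  apply: cvg_trans C2; apply: near_eq_cvg; near=> n.
  by rewrite one_sub_meanE//; near: n; exists 1%N.
have a0 n : (0 < n)%N -> 0 < a n by move=> /one_sub_mean_itv/andP[].
have M2 := ereal_ratio_cvg _ _ _ _ (fun n _ => fact_moment_ge0 2 (xi0 n)) a0 R2 _ e0.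
have [nu0|nu0] := eqVneq nu 0.
  near=> n => u uI; have /andP[u0 u1] := uI.
  have n0 : (0 < n)%N by near: n; exists 1%N.
  have [f2 M2n] : fact_moment 2 (xi0 n) \is a fin_num /\
    `|fine (fact_moment 2 (xi0 n)) - nu * a n| <= e * a n by near: n.
  have fin k : (0 < k <= 2)%N -> fact_moment k (xi0 n) \is a fin_num.
    by case: k => [|[|[|]]]// _; rewrite fact_moment1 mean_fin_num.
  have := pgf_expansion P (xi0 n) 2 u fin uI.
  rewrite big_nat_recr//= big_nat1 fact_moment0 fact_moment1/=.
  move: M2n; rewrite nu0 mul0r subr0 => /(le_trans (ler_norm _)) M2n.
  set p := nat_pgf _ _ _; set m := fine (mean _); set m2 := fine _ in M2n * => H.
  rewrite (_ : _ - _ = p - (1 - m * u)); last by rewrite /h /a -/p -/m; field.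
  rewrite (_ : _ - _ = p - (1 - m * u)) in H; last by rewrite !fact0 factS fact0 expr0
    expr1; field.
  apply: (le_trans H).
  have u2 : u ^+ 2 <= u by rewrite expr2 ler_piMr.
  have m0 : 0 <= m2 by rewrite fine_ge0// fact_moment_ge0.
  apply: (@le_trans _ _ (m2 * u)); last by rewrite ler_wpM2r.
  by rewrite ler_pM// ?mulr_ge0// ler_piMr// invf_le1// ler1n.
have nup : 0 < nu by rewrite lt_neqAle eq_sym nu0.
have R3 : (fact_moment 3 (xi0 n) / (a n)%:E)%E @[n --> \oo] --> 0%E.
  apply: cvg_trans (C3 nup); apply: near_eq_cvg; near=> n.
  by rewrite one_sub_meanE//; near: n; exists 1%N.
have M3 := ereal_ratio_cvg _ _ _ _ (fun n _ => fact_moment_ge0 3 (xi0 n)) a0 R3 _ e0.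
near=> n => u uI; have /andP[u0 u1] := uI.
have n0 : (0 < n)%N by near: n; exists 1%N.
have [f2 M2n] : fact_moment 2 (xi0 n) \is a fin_num /\
  `|fine (fact_moment 2 (xi0 n)) - nu * a n| <= e * a n by near: n.
have [f3 M3n] : fact_moment 3 (xi0 n) \is a fin_num /\
  `|fine (fact_moment 3 (xi0 n)) - 0 * a n| <= e * a n by near: n.
have fin k : (0 < k <= 3)%N -> fact_moment k (xi0 n) \is a fin_num.
  by case: k => [|[|[|[|]]]]// _; rewrite fact_moment1 mean_fin_num.
have := pgf_expansion P (xi0 n) 3 u fin uI.
rewrite big_nat_recr//= big_nat_recr//= big_nat1 fact_moment0 fact_moment1/=.
move: M3n; rewrite mul0r subr0 => /(le_trans (ler_norm _)) M3n.
have m30 : 0 <= fine (fact_moment 3 (xi0 n)) by rewrite fine_ge0// fact_moment_ge0.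
move: M2n M3n m30.
set p := nat_pgf _ _ _; set m := fine (mean _); set m2 := fine (fact_moment 2 _).
set m3 := fine _ => M2n M3n m30.
rewrite !factS fact0 !muln1 expr0 expr1 => H.
have an : 0 < a n by exact: a0.
have -> : u - h n u - a n * (u + nu / 2 * u ^+ 2) =
   (p - (1 * (1 / 1) * 1 + -1 * (m / 1) * u + (-1) ^+ 2 * (m2 / 2) * u ^+ 2))
   + (m2 - nu * a n) * (u ^+ 2 / 2).
  by rewrite /h -/p /a -/m; field.
have u2 : u ^+ 2 <= u by rewrite expr2 ler_piMr.
have u3 : u ^+ 3 <= u by rewrite exprS ler_piMr// exprn_ile1.
rewrite (le_trans (ler_normD _ _))//.
have -> : e * a n * u = e * a n / 2 * u + e * a n / 2 * u by field.
rewrite lerD//.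
  apply: (le_trans H).
  apply: (@le_trans _ _ (e * a n / 6 * u)).
    rewrite ler_pM ?exprn_ge0// ?divr_ge0//.
    by rewrite ler_pM// ?invr_ge0.
  rewrite ler_wpM2r// ler_wpM2l// ?mulr_ge0 ?(ltW e0) ?(ltW an)//.
  by rewrite lef_pV2 ?posrE// ler_nat.
rewrite normrM (ger0_norm (x := u ^+ 2 / 2)) ?divr_ge0 ?exprn_ge0//.
rewrite -mulrA ler_pM ?divr_ge0 ?exprn_ge0// mulrC ler_wpM2l//.
Unshelve. all: by end_near. Qed.

Lemma immigration_expansion K e : (0 < K)%N -> 0 < e -> \forall n \near \oo,
  forall u, 0 <= u <= 1 ->
  `|q n u - a n * \sum_(1 <= k < K) (-1) ^+ k.-1 * lam k * u ^+ k|
    <= a n * (lam K * u ^+ K + e * u).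
Proof.
(* The [K.-1] terms of the sum and the remainder each contribute at most [e1 * a n * u]. *)
move=> K0 e0; pose e1 := e / (K%:R + 1).
have K1 : 0 < K%:R + 1 :> R by rewrite ltr_wpDl.
have e10 : 0 < e1 by rewrite divr_gt0.
have a0 n : (0 < n)%N -> 0 < a n by move=> /one_sub_mean_itv/andP[].
have mom k : (0 < k)%N -> \forall n \near \oo, fact_moment k (eps n) \is a fin_num /\
    `|fine (fact_moment k (eps n)) / k`!%:R - lam k * a n| <= e1 * a n.
  move=> k0; have kf : 0 < k`!%:R :> R by rewrite ltr0n fact_gt0.
  have Rk : (fact_moment k (eps n) / (k`!%:R * a n)%:E)%E @[n --> \oo] --> (lam k)%:E.
    apply: cvg_trans (lam_lim _ k0); apply: near_eq_cvg; near=> n.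
    by rewrite EFinM one_sub_meanE//; near: n; exists 1%N.
  have b0 n : (0 < n)%N -> 0 < k`!%:R * a n by move=> n0; rewrite mulr_gt0// a0.
  have := ereal_ratio_cvg _ _ _ _ (fun n _ => fact_moment_ge0 k (eps n)) b0 Rk _ e10.
  apply: filterS => n [fin H]; split=> //.
  have -> : fine (fact_moment k (eps n)) / k`!%:R - lam k * a n =
      (fine (fact_moment k (eps n)) - lam k * (k`!%:R * a n)) / k`!%:R.
    by field; rewrite gt_eqF.
  rewrite normrM normfV (gtr0_norm kf) ler_pdivrMr// (le_trans H)//.
  by rewrite mulrA mulrAC.
(* The rank depends on the order k; finitely many orders occur, so one rank serves them all. *)
have all_mom : \forall n \near \oo, forall k, (0 < k <= K)%N ->
    fact_moment k (eps n) \is a fin_num /\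
    `|fine (fact_moment k (eps n)) / k`!%:R - lam k * a n| <= e1 * a n.
  elim: (K) => [|L IH].
    by apply: nearW => n k /andP[k0]; rewrite leqNgt k0.
  have HL := mom L.+1 isT.
  near=> n => k /andP[k0]; rewrite leq_eqVlt => /orP[/eqP->|kL]; first by near: n.
  move: k k0 kL; near: n; apply: filterS IH => n H k k0 kL; apply: H.
  by rewrite k0.
near=> n => u uI; have /andP[u0 u1] := uI.
have n0 : (0 < n)%N by near: n; exists 1%N.
have an := a0 _ n0.
have Hn : forall k, (0 < k <= K)%N -> fact_moment k (eps n) \is a fin_num /\
    `|fine (fact_moment k (eps n)) / k`!%:R - lam k * a n| <= e1 * a n by near: n.
have := pgf_expansion P (eps n) K u (fun k kK => (Hn k kK).1) uI.
rewrite big_ltn// fact_moment0 fact0 expr0 divr1 !mulr1.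
pose M k := fine (fact_moment k (eps n)) / k`!%:R.
rewrite -/(M K) => H.
have MK : M K <= a n * (lam K + e1).
  have [_ /(le_trans (ler_norm _))] := Hn K (introT andP (conj K0 (leqnn K))).
  rewrite lerBlDr -/(M K) => /le_trans; apply.
  by rewrite le_eqVlt; apply/orP; left; apply/eqP; ring.
have -> : q n u - a n * (\sum_(1 <= k < K) (-1) ^+ k.-1 * lam k * u ^+ k) =
   - (nat_pgf P (eps n) (1 - u) - (1 + \sum_(1 <= k < K) (-1) ^+ k * M k * u ^+ k)) +
   \sum_(1 <= k < K) (-1) ^+ k.-1 * (M k - lam k * a n) * u ^+ k.
  have -> : \sum_(1 <= k < K) (-1) ^+ k.-1 * (M k - lam k * a n) * u ^+ k =
     - (\sum_(1 <= k < K) (-1) ^+ k * M k * u ^+ k)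
     - a n * (\sum_(1 <= k < K) (-1) ^+ k.-1 * lam k * u ^+ k).
    rewrite mulr_sumr -!sumrN -big_split/=; apply: eq_big_nat => k /andP[k0 _].
    have -> : (-1) ^+ k = - (-1) ^+ k.-1 :> R by rewrite -{1}(prednK k0) exprS mulN1r.
    by ring.
  by rewrite /q; ring.
rewrite (le_trans (ler_normD _ _))// normrN (le_trans (lerD H (lexx _)))//.
have S : `|\sum_(1 <= k < K) (-1) ^+ k.-1 * (M k - lam k * a n) * u ^+ k| <=
   K%:R * (e1 * a n * u).
  rewrite (le_trans (ler_norm_sum _ _ _))//.
  apply: (@le_trans _ _ (\sum_(1 <= k < K) e1 * a n * u)).
    rewrite big_nat_cond [leRHS]big_nat_cond; apply: ler_sum => k /andP[/andP[k0 kK] _].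
    rewrite 2!normrM normrX normrN1 expr1n mul1r normrX (ger0_norm u0).
    rewrite ler_pM ?exprn_ge0//.
      by have [] := Hn k (introT andP (conj k0 (ltnW kK))).
    by rewrite -(prednK k0) exprS ler_piMr// exprn_ile1.
  have x0 : 0 <= e1 * a n * u by rewrite !mulr_ge0// ltW.
  by rewrite sumr_const_nat -[leLHS]mulr_natl ler_wpM2r// ler_nat leq_subr.
apply: (@le_trans _ _ (a n * (lam K + e1) * u ^+ K + K%:R * (e1 * a n * u))).
  by rewrite lerD// ler_wpM2r// exprn_ge0.
have eE : e = (K%:R + 1) * e1 by rewrite /e1 mulrCA divff ?mulr1// gt_eqF.
have uK' : u ^+ K <= u by rewrite -(prednK K0) exprS ler_piMr// exprn_ile1.
have uK : a n * e1 * u ^+ K <= a n * e1 * u by rewrite ler_wpM2l// mulr_ge0// ltW.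
have -> : a n * (lam K * u ^+ K + e * u) = a n * lam K * u ^+ K + (a n * e1 * u +
  K%:R * (e1 * a n * u)) by rewrite eE; ring.
by rewrite mulrDr mulrDl -addrA lerD2l lerD2r.
Unshelve. all: by end_near. Qed.

(* The recursion starts at n0 because the first eps n may have infinite mean. *)
Fixpoint cumulant (n0 n : nat) (u : R) : R :=
  if n is m.+1 then
    if (n0 <= m)%N then cumulant n0 m (h m.+1 u) + q m.+1 u else 0
  else 0.

Lemma cumulant_init n0 n u : (n <= n0)%N -> cumulant n0 n u = 0.
Proof. by case: n => //= n; rewrite ltnNge => /negbTE ->. Qed.

Lemma eq_gfun (c : nat -> R) (F F' : R -> R) : gfun R c F ->
  (forall s, 0 <= s <= 1 -> F s = F' s) -> gfun R c F'.
Proof. by move=> [c0 cF] FF'; split=> // s sI; rewrite -FF'//; exact: cF. Qed.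

(** Induction: composing with the offspring generating function and adding that of the immigration
    keep the coefficients nonnegative. Both functions equal 1 at s = 1, which preserves the form
    [F 1 - F s]. *)
Lemma cumulant_gfun n0 n : exists (c : nat -> R) (F : R -> R), gfun R c F /\
  forall s, 0 <= s <= 1 -> cumulant n0 n (1 - s) = F 1 - F s.
Proof.
have zero : exists (c : nat -> R) (F : R -> R), gfun R c F /\
    forall s, 0 <= s <= 1 -> 0 = F 1 - F s.
  exists (fun=> 0), (fun=> 0); split; last by move=> s _; rewrite subrr.
  split=> // s _; apply: cvg_near_cst; apply: nearW => m.
  by rewrite big1// => j _; rewrite mul0r.
elim: n => [|n [c [F [cF HF]]]]; first exact: zero.
rewrite /=; have [n0n|n0n] := leqP n0 n; last exact: zero.
have fI s : 0 <= s <= 1 -> 0 <= nat_pgf P (xi0 n.+1) s <= 1 by exact: nat_pgf_itv.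
have /choice[kappa Hk] : forall j, exists kappa : nat -> R,
    gfun R kappa (fun s => nat_pgf P (xi0 n.+1) s ^+ j).
  by move=> j; exact: (offspring_pgf_power P xi0 xi eps xi_eps_indep xi_ident).
have [c' c'F] := gfun_comp _ _ _ _ _ cF Hk fI.
exists (fun j => c' j + nat_pmf P (eps n.+1) j),
  (fun s => F (nat_pgf P (xi0 n.+1) s) + nat_pgf P (eps n.+1) s); split.
  exact: gfunD c'F (nat_pgf_gfun P (eps n.+1)).
move=> s sI; rewrite /h /q !subKr HF; last exact: fI.
by rewrite !nat_pgf1; ring.
Qed.

Lemma gwvei_limit :
  exists (d' : measure_display) (T' : measurableType d')
    (P' : probability T' R) (Y : {RV P' >-> nat}),
  [/\ cvg_in_distribution P P' (gwvei xi eps) Y,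
      compound_poisson Y
    & forall s : R, 0 < s <= 1 ->
        cvgn (fun K => \sum_(1 <= k < K) exponent_term nu lam s k) /\
        pgf Y s =
          (expR (- limn (fun K => \sum_(1 <= k < K) exponent_term nu lam s k)))%:E].
Proof.
have lam1 : 0 <= lam 1%N by exact: lam_ge0.
have qI n u : 0 <= u <= 1 -> 0 <= q n u <= 1 by exact: one_sub_pgf_itv.
(* At order 1 the sum is empty, and tolerance 1 gives [q n u <= C * a n * u] from rank [n0] on. *)
have [n0 _ Hn0] := immigration_expansion 1 1 isT ltr01.
pose C := lam 1%N + 1.
have C0 : 0 < C by rewrite ltr_wpDl.
have q_bound n u : (n0 < n)%N -> 0 <= u <= 1 -> 0 <= q n u <= C * a n * u.
  move=> n0n uI; have /andP[-> _] := qI n u uI; rewrite andTb.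
  have := Hn0 n (ltnW n0n) u uI; rewrite big_geq// mulr0 subr0 => /(le_trans (ler_norm _)).
  by move=> /le_trans; apply; rewrite expr1 mul1r /C le_eqVlt; apply/orP; left;
    apply/eqP; ring.
have q_le1 n u : (n0 < n)%N -> 0 <= u <= 1 -> q n u <= 1.
  by move=> _ /(qI n)/andP[].
pose G := cumulant n0.
pose H n u := nat_pgf P (gwvei xi eps n) (1 - u).
have lam_small := limn_esup_root_pow_cvg0 _ _ _ lam_ge0 lam_limsup.
have G_init u : G n0 u = 0 by exact: cumulant_init.
have G_rec n u : (n0 <= n)%N -> 0 <= u <= 1 -> G n.+1 u = G n (h n.+1 u) + q n.+1 u.
  by move=> n0n _; rewrite /G/= n0n.
have Yrv n := nat_rv P _ (measurable_gwvei P xi eps n).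
have Ygf n : gfun R (nat_pmf P (gwvei xi eps n)) (nat_pgf P (gwvei xi eps n)).
  by have [Z <-] := Yrv n; exact: nat_pgf_gfun.
have Y1 n : nat_pgf P (gwvei xi eps n) 1 = 1.
  by have [Z <-] := Yrv n; exact: nat_pgf1.
have sI u : 0 <= u <= 1 -> 0 <= 1 - u <= 1.
  by move=> /andP[u0 u1]; rewrite subr_ge0 u1 gerBl.
have H_bound n u : 0 <= u <= 1 -> 0 <= H n u <= 1.
  by move=> /sI uI; have [Z ZE] := Yrv n; rewrite /H -ZE; exact: nat_pgf_itv.
have H_cont n e : 0 < e -> exists2 d, 0 < d &
    forall u, 0 <= u <= 1 -> u <= d -> `|H n u - 1| <= e.
  move=> e0; have [dl dl0 Hd] := gfun_left_continuous _ _ _ e (Ygf n) e0.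
  exists dl => // u uI ud; have := Hd u uI ud; rewrite Y1.
  have /andP[_ H1] := H_bound n u uI.
  by rewrite -/(H n u) distrC ger0_norm ?subr_ge0// lerBlDr -lerBlDl.
have H_rec n u : 0 <= u <= 1 -> H n.+1 u = H n (h n.+1 u) * (1 - q n.+1 u).
  move=> /sI uI; rewrite /H (nat_pgf_gwveiS P xi0 xi eps xi_eps_indep xi_ident)//.
  by rewrite /h /q !subKr.
pose E u := limn (fun K => \sum_(1 <= k < K) exponent_term nu lam (1 - u) k).
have G_lim u : 0 <= u < 1 -> G n u @[n --> \oo] --> E u.
  exact: (additive_recursion_cvg _ _ _ _ _ _ nu_ge0 lam_ge0 one_sub_mean_itv
    one_sub_mean_cvg0 one_sub_mean_sum offspring_contraction offspring_expansion
    immigration_expansion _ _ _ lam_small (ltW C0) q_bound G_init G_rec).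
have E_bound u : 0 <= u < 1 -> 0 <= E u <= lam 1%N * u.
  exact: (exponent_lim_bound _ _ _ _ _ _ nu_ge0 lam_ge0 one_sub_mean_itv
    one_sub_mean_cvg0 one_sub_mean_sum offspring_contraction offspring_expansion
    immigration_expansion _ _ _ lam_small (ltW C0) q_bound G_init G_rec).
have E_cvg u : 0 <= u < 1 -> cvgn (fun K => \sum_(1 <= k < K) exponent_term nu lam (1 -
  u) k).
  exact: (exponent_sum_cvg _ _ _ _ _ _ nu_ge0 lam_ge0 one_sub_mean_itv one_sub_mean_cvg0
    one_sub_mean_sum offspring_contraction offspring_expansion
    immigration_expansion _ _ _ lam_small (ltW C0) q_bound G_init G_rec).
have H_lim u : 0 <= u < 1 -> H n u @[n --> \oo] --> expR (- E u).
  exact: (multiplicative_recursion_cvg _ _ _ _ _ _ nu_ge0 lam_ge0 one_sub_mean_itv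
    one_sub_mean_cvg0 one_sub_mean_sum offspring_contraction offspring_expansion
    immigration_expansion _ _ _ _ lam_small (ltW C0) q_bound q_le1 G_init G_rec H_cont
      H_rec).
have G_b n u : 0 <= u <= 1 -> 0 <= G n u <= C * u.
  move=> uI; have /andP[u0 u1] := uI; have [nn0|nn0] := leqP n n0.
    by rewrite /G cumulant_init// lexx mulr_ge0// ltW.
  exact: (additive_recursion_bound _ _ _ _ one_sub_mean_itv offspring_contraction _ _ _
    (ltW C0) q_bound G_init G_rec _ _ (ltnW nn0) uI).
have one01 : 0 <= (1 : R) <= 1 by rewrite ler01 lexx.
have zero01 : 0 <= (0 : R) <= 1 by rewrite ler01 lexx.
(* The coefficients have total mass C; the mass at 0 corresponds to summands Z i
   equal to 0 in the compound Poisson sum. *)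
have /choice[c cG] : forall n, exists c : nat -> R, gfun R c (fun s => C - G n (1 - s)).
  move=> n; have [c [F [cF HF]]] := cumulant_gfun n0 n.
  have F0 : F 0 = c 0%N by rewrite (gfun_recl _ _ _ _ cF)// mul0r addr0.
  (* The new constant coefficient is [C - G n 1], nonnegative by the bound on [G] at u = 1. *)
  have b0 : 0 <= C - (F 1 - c 0%N).
    rewrite -F0 -HF// subr0 subr_ge0; have /andP[_] := G_b n 1 one01.
    by rewrite mulr1.
  exists (fun j => if j is 0%N then C - (F 1 - c 0%N) else c j).
  apply: eq_gfun (gfun_head _ _ _ _ cF b0) _ => s /HF; rewrite -/(G n) => ->.
  by ring.
have E0 : E 0 = 0.
  apply/eqP; rewrite eq_le andbC; have := E_bound 0.
  by rewrite mulr0 lexx ltr01 => /(_ isT).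
(* At s = 0 the exponent series may diverge, so the value there is taken from the limit
   coefficients. *)
have [r rE] : exists r : nat -> R,
    gfun R r (fun s => if s == 0 then r 0%N else C - E (1 - s)).
  apply: (gfun_coef_lim _ c (fun n s => C - G n (1 - s)) _ C cG).
  - by move=> n; rewrite subrr gerBl; have /andP[] := G_b n 0 zero01.
  - move=> s /andP[s0 s1]; apply: cvgB; first exact: cvg_cst.
    by apply: G_lim; rewrite subr_ge0 s1 gtrBl.
  (* For this u, [E u <= lam 1 * u <= C * u <= e], which is left continuity at s = 1; the bound 1/2
     keeps [1 - u] inside the open interval. *)
  move=> e e0; pose u := Num.min (1 / 2) (e / C).
  have u0 : 0 < u by rewrite lt_min !divr_gt0.
  have u2 : u <= 1 / 2 by rewrite ge_min lexx.
  have u1 : u < 1 by lra.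
  have ue : C * u <= e by rewrite mulrC -ler_pdivlMr// ge_min lexx orbT.
  exists (1 - u); first by rewrite subr_gt0 u1 gtrBl.
  rewrite subrr E0 subr0 subKr lerD2l lerN2.
  have uI : 0 <= u < 1 by rewrite ltW.
  have /andP[_ Eu] := E_bound u uI.
  rewrite (le_trans Eu)// (le_trans _ ue)// ler_wpM2r ?(ltW u0)// /C lerDl ler01.
  by [].
have r1 : (if (1 : R) == 0 then r 0%N else C - E (1 - 1)) = C.
  by rewrite oner_eq0 subrr E0 subr0.
have [d' [T' [P' [Y [cpY Ypgf]]]]] := compound_poisson_exists _ _ _ _ rE C0 r1.
have YE s : 0 < s <= 1 -> nat_pgf P' Y s = expR (- E (1 - s)).
  move=> /andP[s0 s1]; rewrite Ypgf ?(ltW s0)// gt_eqF//.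
  by congr (expR (- _)); rewrite subKr.
exists d', T', P', Y; split => //.
  have /choice[Z ZE] := Yrv.
  have := cvg_in_distribution_pmf _ _ _ _ P P' Z Y.
  have -> : (fun n => Z n : T -> nat) = gwvei xi eps by apply/funext => n.
  apply => j.
  suff : nat_pmf P (Z n) j - nat_pmf P' Y j @[n --> \oo] --> 0.
    by move=> /subr_cvg0.
  (* The coefficients are the point probabilities, and the second family is constantly that of
     [Y]. *)
  apply: (@gfun_coef_cvg R nat \oo _ (fun n => nat_pmf P (Z n)) (fun=> nat_pmf P' Y) (fun
    n => nat_pgf P (Z n)) (fun=> nat_pgf P' Y) 1).
  - by move=> n; exact: nat_pgf_gfun.
  - by move=> n; exact: nat_pgf_gfun.
  - by move=> n; rewrite nat_pgf1.
  - by move=> n; rewrite nat_pgf1.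
  move=> s /andP[s0 s1]; rewrite YE ?s0 ?ltW//.
  apply/subr_cvg0; have := H_lim (1 - s).
  rewrite /H subr_ge0 (ltW s1) gtrBl s0 => /(_ isT).
  by under eq_fun do rewrite subKr -ZE.
move=> s s01; have /andP[s0 s1] := s01.
have uI : 0 <= 1 - s < 1 by rewrite subr_ge0 s1 gtrBl.
have -> : (fun K => \sum_(1 <= k < K) exponent_term nu lam s k) =
   (fun K => \sum_(1 <= k < K) exponent_term nu lam (1 - (1 - s)) k).
  by rewrite subKr.
split; first exact: E_cvg.
by rewrite nat_pgfE ?(ltW s0)// YE.
Qed.

End gwvei_limit_theorem.

Theorem theorem3 (R : realType) (d : measure_display) (T : measurableType d)
    (P : probability T R)
    (xi0 : nat -> {RV P >-> nat}) (xi : nat -> nat -> {RV P >-> nat})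
    (eps : nat -> {RV P >-> nat})
    (nu : R) (lam : nat -> R)
    (xi_eps_indep : mutually_independent gwvei_index (gwvei_family xi eps))
    (xi_ident : forall n j, (0 < n)%N -> (0 < j)%N ->
       distribution P (xi n j) = distribution P (xi0 n))
    (C1_lt1 : forall n, (0 < n)%N -> (mean (xi0 n) < 1)%E)
    (C1_lim : mean (xi0 n) @[n --> \oo] --> 1%E)
    (C1_sum : (\sum_(1 <= n <oo) (1 - mean (xi0 n)) = +oo)%E)
    (nu_ge0 : 0 <= nu)
    (C2 : (fact_moment 2 (xi0 n) / (1 - mean (xi0 n)))%E @[n --> \oo]
            --> nu%:E)
    (C3 : 0 < nu ->
       (fact_moment 3 (xi0 n) / (1 - mean (xi0 n)))%E @[n --> \oo] --> 0%E)
    (lam_ge0 : forall k, (0 < k)%N -> 0 <= lam k)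
    (lam_lim : forall k, (0 < k)%N ->
       (fact_moment k (eps n) / (k`!%:R%:E * (1 - mean (xi0 n))))%E
         @[n --> \oo] --> (lam k)%:E)
    (lam_limsup : (limn_esup (fun n => (lam n `^ n%:R^-1)%:E) <= 1)%E) :
  exists (d' : measure_display) (T' : measurableType d')
    (P' : probability T' R) (Y : {RV P' >-> nat}),
  [/\ cvg_in_distribution P P' (gwvei xi eps) Y,
      compound_poisson Y
    & forall s : R, 0 < s <= 1 ->
        cvgn (fun K => \sum_(1 <= k < K) exponent_term nu lam s k) /\
        pgf Y s =
          (expR (- limn (fun K => \sum_(1 <= k < K) exponent_term nu lam s k)))%:E].
Proof.
exact: (gwvei_limit P xi0 xi eps nu lam xi_eps_indep xi_ident C1_lt1 C1_lim C1_sum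
  nu_ge0 C2 C3 lam_ge0 lam_lim lam_limsup).
Qed.
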